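(* \textsc{Class Domination Coloring} can be solved in $O^*(2^k)$ time, where $k$ is the size of a clique modulator of the input graph (given as input).
   Context: All graphs are finite and simple; $N_G[v]=N_G(v)\cup\{v\}$. A coloring $\chi:V(G)\to C$ is proper if adjacent vertices get different colors; $|\chi|$ is the number of colors used. A vertex $v$ dominates a set $S$ if $S\subseteq N_G[v]$. A CD coloring of $G$ is a proper coloring $\chi$ such that every color class $\chi^{-1}(c)$ ($c$ in the image) is dominated by some vertex of $G$. \textsc{Class Domination Coloring}: given $G$ and an integer $\ell$, decide whether $G$ has a CD coloring with at most $\ell$ colors. A clique modulator of $G$ is a set $M\subseteq V(G)$ such that $G-M$ is a clique. $O^*(\cdot)$ hides factors polynomial in the input size. *)

(* Defs.v *)
From mathcomp Require Import all_boot all_order all_algebra.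

Set Implicit Arguments.
Unset Strict Implicit.
Unset Printing Implicit Defensive.

(** ** Graphs and class domination colorings

    A finite simple graph is a symmetric irreflexive [e : rel V] on a finite
    type [V]. *)

Section Graphs.
Variables (V : finType) (e : rel V).

Definition simple_graph : Prop := symmetric e /\ irreflexive e.

Definition closed_nbh (v : V) : {set V} := v |: [set u | e v u].

Definition dominates (v : V) (S : {set V}) : bool := S \subset closed_nbh v.

Definition clique (K : {set V}) : Prop :=
  forall u v, u \in K -> v \in K -> u != v -> e u v.

Definition clique_modulator (M : {set V}) : Prop := clique (~: M).

Section Colorings.
Variables (C : finType) (chi : V -> C).

Definition proper_coloring : Prop := forall u v, e u v -> chi u != chi v.

Definition color_class (c : C) : {set V} := [set v | chi v == c].

Definition num_colors : nat := #|codom chi|.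

Definition CD_coloring : Prop :=
  proper_coloring /\
  forall c, c \in codom chi -> exists v, dominates v (color_class c).

End Colorings.

Definition has_CD_coloring (l : int) : Prop :=
  exists (C : finType) (chi : V -> C),
    CD_coloring chi /\ ((num_colors chi)%:Z <= l)%R.

End Graphs.

(** ** Random access machine with logarithmic cost

    Programs are structured (while-programs) over integer registers and an
    integer memory with indirect addressing.  As in the logarithmic cost
    criterion of Aho, Hopcroft and Ullman, an operation is charged the bit
    length of the values and of the memory addresses that it handles.
    Multiplication and division are charged the product of the bit lengths of
    the operands, the cost of the schoolbook algorithms, so that arithmetic on
    long integers is never undercharged.  The index of a register is a constant
    of the program and is not charged. *)

(** floor (log2 |z|) + 1, and 1 for z = 0 *)
Definition bits (z : int) : nat := (trunc_log 2 `|z|%N).+1.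

Inductive binop := Add | Sub | Mul | Div.

Inductive expr :=
  | Cst of int
  | Reg of nat
  | Fetch of expr
  | Op of binop & expr & expr.

Inductive cmd :=
  | Skip
  | Assign of nat & expr    (* register := value *)
  | Store of expr & expr    (* memory[address] := value *)
  | Seq of cmd & cmd
  | If of expr & cmd & cmd  (* the tests of [If] and [While] are [0 < value] *)
  | While of expr & cmd.

Record state := State { regs : nat -> int; cells : nat -> int }.

Definition set_reg (s : state) (x : nat) (z : int) : state :=
  State (fun y => if y == x then z else regs s y) (cells s).

Definition set_mem (s : state) (a : nat) (z : int) : state :=
  State (regs s) (fun b => if b == a then z else cells s b).

Definition op_val (o : binop) (x y : int) : int :=
  match o with
  | Add => (x + y)%R
  | Sub => (x - y)%R
  | Mul => (x * y)%R
  | Div => (x %/ y)%Z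
  end.

Definition op_cost (o : binop) (x y : int) : nat :=
  match o with
  | Add | Sub => bits x + bits y
  | Mul | Div => bits x * bits y
  end.

(** The memory address denoted by an integer is its absolute value. *)
Fixpoint eval (s : state) (a : expr) : int :=
  match a with
  | Cst z => z
  | Reg x => regs s x
  | Fetch b => cells s `|eval s b|%N
  | Op o b c => op_val o (eval s b) (eval s c)
  end.

Fixpoint cost (s : state) (a : expr) : nat :=
  match a with
  | Cst z => bits z
  | Reg x => bits (regs s x)
  | Fetch b => cost s b + bits (eval s b) + bits (eval s a)
  | Op o b c => cost s b + cost s c + op_cost o (eval s b) (eval s c)
  end.

(** [exec p s t s']: started in [s], [p] halts in [s'] after time [t]. *)
Inductive exec : cmd -> state -> nat -> state -> Prop :=
  | exec_skip s : exec Skip s 1 s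
  | exec_assign s x a :
      exec (Assign x a) s (cost s a + bits (eval s a)) (set_reg s x (eval s a))
  | exec_store s a b :
      exec (Store a b) s
           (cost s a + cost s b + bits (eval s a) + bits (eval s b))
           (set_mem s `|eval s a|%N (eval s b))
  | exec_seq p q s s1 s2 t1 t2 :
      exec p s t1 s1 -> exec q s1 t2 s2 -> exec (Seq p q) s (t1 + t2) s2
  | exec_if a p q s s1 t :
      exec (if (0 < eval s a)%R then p else q) s t s1 ->
      exec (If a p q) s (cost s a + bits (eval s a) + t) s1
  | exec_while_end a p s :
      ~~ (0 < eval s a)%R ->
      exec (While a p) s (cost s a + bits (eval s a)) s
  | exec_while_loop a p s s1 s2 t1 t2 :
      (0 < eval s a)%R ->
      exec p s t1 s1 -> exec (While a p) s1 t2 s2 ->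
      exec (While a p) s (cost s a + bits (eval s a) + t1 + t2) s2.

(** The input is stored in the first memory cells; everything else is 0. *)
Definition init (input : seq int) : state :=
  State (fun _ => 0%R) (nth 0%R input).

Definition input_size (input : seq int) : nat := \sum_(z <- input) bits z.

(** On [input], [p] halts within time [T], and register 0 then holds the answer
    to the question [Q], as 1 for yes and 0 for no. *)
Definition decides_within (p : cmd) (input : seq int) (Q : Prop) (T : nat) :
    Prop :=
  exists (t : nat) (s : state),
    [/\ exec p (init input) t s, t <= T &
        (Q /\ regs s 0 = 1%R) \/ (~ Q /\ regs s 0 = 0%R)].

(** The number of vertices, the bound on the number of colors, the adjacency
    matrix row by row, and the characteristic vector of the modulator. *)
Definition encode (n : nat) (e : rel 'I_n) (l : int) (M : {set 'I_n}) :
    seq int :=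
  [:: Posz n, l &
      [seq Posz (e u v) | u <- enum 'I_n, v <- enum 'I_n] ++
      [seq Posz (v \in M) | v <- enum 'I_n]].

(* Main.v *)
Require Import Defs.
From mathcomp Require Import all_boot all_order all_algebra.
From mathcomp Require Import zify ring.

(** Write K for the clique V \ M.  A color class contains at most one vertex of
    K, so a CD coloring amounts to one class for each vertex of K and at most
    l - |K| further classes inside M.  Classes may be shrunk, so it suffices that
    their traces on M cover M.  By inclusion-exclusion the number of such covers,
    each class being counted with each of its dominating vertices w, is
      sum_(X <= M) (-1)^|M \ X| * prod_v g_v(X),
    where g_v(X) is a sum over w of numbers of stable subsets of X & N[w] or, for
    a class that contains v in K, of (X & N[w]) \ N[v].  All these numbers are
    read off a table of size 2^|M|, filled with the recurrence
      i(v + Y) = i(Y) + i(Y \ N[v]).  *)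

Set Implicit Arguments.
Unset Strict Implicit.
Unset Printing Implicit Defensive.

Import Order.TTheory GRing.Theory Num.Theory.

(** * Running time of programs *)

Lemma absz_lt_bits z : `|z| < 2 ^ bits z.
Proof. by rewrite /bits trunc_log_ltn. Qed.

Lemma bits_leq z B : 0 < B -> (bits z <= B) = (`|z| < 2 ^ B).
Proof.
move=> B0; apply/idP/idP => [zB|].
  by apply: (leq_trans (absz_lt_bits z)); rewrite leq_exp2l.
have [z0|z0] := posnP `|z|; first by rewrite /bits z0 trunc_log0.
by move=> zB; rewrite /bits -(ltn_exp2l _ _ (isT : 1 < 2)); apply: leq_ltn_trans zB;
  exact: trunc_logP.
Qed.

Lemma op_val_bits o x y : bits (op_val o x y) <= bits x + bits y.
Proof.
rewrite bits_leq // expnD.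
have := absz_lt_bits x; have := absz_lt_bits y.
have : 0 < 2 ^ bits x by rewrite expn_gt0.
have : 0 < 2 ^ bits y by rewrite expn_gt0.
move: (2 ^ bits x) (2 ^ bits y) => a b.
by case: o => /= b0 a0 yb xa; nia.
Qed.

(** On states whose values have at most [W] bits, evaluating an expression [a]
    costs at most [cost_factor a * W ^ 2], and every expression of the program
    has a factor below [unit_factor]; [run] therefore measures time in units of
    [unit_factor * W ^ 2]. *)
Definition unit_factor := 400.

Fixpoint value_factor (a : expr) : nat :=
  match a with
  | Cst z => bits z
  | Reg _ => 1
  | Fetch _ => 1
  | Op _ b c => value_factor b + value_factor c
  end.

Fixpoint cost_factor (a : expr) : nat :=
  match a with
  | Cst z => bits z
  | Reg _ => 1
  | Fetch b => cost_factor b + value_factor b + 1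
  | Op _ b c => cost_factor b + cost_factor c +
                (value_factor b).+1 * (value_factor c).+1
  end.

Definition light (a : expr) : bool := cost_factor a + value_factor a <= unit_factor.

Fixpoint writes (p : cmd) : seq nat :=
  match p with
  | Assign x _ => [:: x]
  | Seq p q | If _ p q => writes p ++ writes q
  | While _ p => writes p
  | _ => [::]
  end.

Fixpoint storeless (p : cmd) : bool :=
  match p with
  | Store _ _ => false
  | Seq p q | If _ p q => storeless p && storeless q
  | While _ p => storeless p
  | _ => true
  end.

Definition frame (p : cmd) (s s' : state) : Prop :=
  (forall x, x \notin writes p -> regs s' x = regs s x) /\
  (storeless p -> cells s' = cells s).

Lemma exec_frame p s t s' : exec p s t s' -> frame p s s'.
Proof.
elim=> {p s t s'} //=.
- by move=> s x a; split=> //= y; rewrite inE => /negbTE->.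
- by move=> p q s s1 s2 t1 t2 _ [r1 c1] _ [r2 c2]; split=> [x|/andP[h1 h2]] /=;
    [rewrite mem_cat negb_or => /andP[h1 h2]; rewrite r2 ?r1|rewrite c2 ?c1].
- move=> a p q s s1 t _ [r c]; split=> [x|/andP[h1 h2]] /=; last by apply: c; case: ifP.
  by rewrite mem_cat negb_or => /andP[h1 h2]; apply: r; case: ifP.
- by move=> a p s s1 s2 t1 t2 _ _ [r1 c1] _ [r2 c2]; split=> [x h|h] /=;
    [rewrite r2 ?r1|rewrite c2 ?c1].
Qed.

Section Run.
Variable W : nat.
Hypothesis W_gt0 : 0 < W.

Definition bounded (s : state) : Prop :=
  (forall x, `|regs s x| < 2 ^ W) /\ (forall a, `|cells s a| < 2 ^ W).

Lemma eval_bits s a : bounded s -> bits (eval s a) <= value_factor a * W.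
Proof.
move=> [rW cW]; elim: a => [z|x|b _|o b IHb c IHc] /=.
- by rewrite leq_pmulr.
- by rewrite mul1n bits_leq.
- by rewrite mul1n bits_leq.
- by rewrite mulnDl; apply: leq_trans (op_val_bits _ _ _) (leq_add _ _).
Qed.

Lemma cost_leq s a : bounded s -> cost s a <= cost_factor a * W ^ 2.
Proof.
move=> sW; have [rW cW] := sW.
elim: a => [z|x|b IHb|o b IHb c IHc] /=.
- by rewrite leq_pmulr // expn_gt0 W_gt0.
- by rewrite mul1n (leq_trans _ (leq_pmulr _ W_gt0)) // bits_leq.
- have hb := eval_bits b sW.
  have hc : bits (cells s `|eval s b|) <= W by rewrite bits_leq.
  rewrite !mulnDl mul1n !leq_add //.
    by apply: leq_trans hb _; rewrite leq_mul2l (leq_pmulr _ W_gt0) orbT.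
  exact: leq_trans hc (leq_pmulr _ W_gt0).
- have hb := eval_bits b sW; have hc := eval_bits c sW.
  rewrite 2!mulnDl leq_add ?leq_add //.
  move: (value_factor b) (value_factor c) hb hc => vb vc hb hc.
  apply: leq_trans (_ : (vb * W).+1 * (vc * W).+1 <= _); last by nia.
  by case: o; rewrite /op_cost; nia.
Qed.

Lemma light_cost s a : bounded s -> light a ->
  cost s a + bits (eval s a) <= unit_factor * W ^ 2.
Proof.
move=> sW la; apply: leq_trans (_ : (cost_factor a + value_factor a) * W ^ 2 <= _).
  rewrite mulnDl leq_add ?cost_leq //; apply: leq_trans (eval_bits a sW) _.
  by rewrite leq_mul2l (leq_pmulr _ W_gt0) orbT.
by rewrite leq_mul2r [_ <= _]la orbT.
Qed.

Definition run (p : cmd) (s : state) (T : nat) (Q : state -> Prop) : Prop :=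
  bounded s -> exists t s',
    [/\ exec p s t s', t <= T * (unit_factor * W ^ 2), bounded s' & Q s'].

Lemma run_conseq p s T T' (Q Q' : state -> Prop) :
  run p s T Q -> T <= T' -> (forall s', frame p s s' -> Q s' -> Q' s') ->
  run p s T' Q'.
Proof.
move=> H TT QQ sW; have [t [s' [ex tT s'W Qs']]] := H sW.
exists t, s'; split=> //; last by apply: QQ => //; exact: exec_frame ex.
by apply: leq_trans tT _; rewrite leq_mul2r TT orbT.
Qed.

Lemma run_skip s (Q : state -> Prop) : Q s -> run Skip s 1 Q.
Proof.
move=> Qs sW; exists 1, s; split=> //; first exact: exec_skip.
by rewrite mul1n muln_gt0 expn_gt0 W_gt0.
Qed.

Lemma run_assign s x a (Q : state -> Prop) :
  light a -> (bounded s -> `|eval s a| < 2 ^ W) -> Q (set_reg s x (eval s a)) ->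
  run (Assign x a) s 1 Q.
Proof.
move=> la aW Qs sW; exists (cost s a + bits (eval s a)), (set_reg s x (eval s a)).
split=> //; [exact: exec_assign|by rewrite mul1n light_cost|].
by split=> [y|b] /=; [case: ifP => _; [exact: aW|]|]; have [] := sW.
Qed.

Lemma run_store s a b (Q : state -> Prop) :
  light a -> light b -> (bounded s -> `|eval s b| < 2 ^ W) ->
  Q (set_mem s `|eval s a| (eval s b)) -> run (Store a b) s 2 Q.
Proof.
move=> la lb bW Qs sW.
exists (cost s a + cost s b + bits (eval s a) + bits (eval s b)), (set_mem s `|eval s a| (eval s b)).
split=> //; first exact: exec_store.
  by rewrite -addnA addnACA mul2n -addnn leq_add ?light_cost.
by split=> [y|c] /=; [|case: ifP => _; [exact: bW|]]; have [] := sW.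
Qed.

Lemma run_seq p q s T1 T2 (Q : state -> Prop) :
  run p s T1 (fun s1 => run q s1 T2 Q) -> run (Seq p q) s (T1 + T2) Q.
Proof.
move=> H sW; have [t1 [s1 [e1 h1 b1 H1]]] := H sW.
have [t2 [s2 [e2 h2 b2 H2]]] := H1 b1.
by exists (t1 + t2), s2; split=> //; [exact: exec_seq e1 e2|rewrite mulnDl leq_add].
Qed.

Lemma run_if a p q s T (Q : state -> Prop) :
  light a -> ((0 < eval s a)%R -> run p s T Q) ->
  (~~ (0 < eval s a)%R -> run q s T Q) ->
  run (If a p q) s T.+1 Q.
Proof.
move=> la Hp Hq sW.
have [t [s' [ex tT bs Qs]]] : exists t s', [/\ exec (if (0 < eval s a)%R then p else q) s t s',
    t <= T * (unit_factor * W ^ 2), bounded s' & Q s'].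
  by case: ifPn => h; [exact: Hp|exact: Hq].
exists (cost s a + bits (eval s a) + t), s'; split=> //; first exact: exec_if.
by rewrite mulSn leq_add // light_cost.
Qed.

Lemma run_for a p s0 N T (I : nat -> state -> Prop) :
  light a -> I 0 s0 ->
  (forall i s, i < N -> frame p s0 s -> I i s ->
     (0 < eval s a)%R /\ run p s T (I i.+1)) ->
  (forall s, frame p s0 s -> I N s -> ~~ (0 < eval s a)%R) ->
  run (While a p) s0 (N * T.+1).+1 (I N).
Proof.
move=> la I0 step stop.
suff H m i s : m = N - i -> i <= N -> frame p s0 s -> I i s ->
    run (While a p) s (m * T.+1).+1 (I N).
  by apply: H I0; [rewrite subn0| |split].
elim: m i s => [|m IH] i s.
  move=> /esym/eqP; rewrite subn_eq0 => Ni iN fr Ii sW.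
  have {Ni iN}iN : i = N by apply/eqP; rewrite eqn_leq iN Ni.
  rewrite iN in Ii; exists (cost s a + bits (eval s a)), s; split=> //.
    exact/exec_while_end/stop.
  by rewrite mul1n light_cost.
move=> mE iN fr Ii sW.
have {}iN : i < N by rewrite -subn_gt0 -mE.
have [apos Hp] := step i s iN fr Ii.
have [t1 [s1 [e1 h1 b1 I1]]] := Hp sW.
have fr1 : frame p s0 s1.
  have [r c] := exec_frame e1; case: fr => [r0 c0].
  by split=> [x h|h]; [rewrite r ?r0|rewrite c ?c0].
have mE' : m = N - i.+1 by rewrite subnS -mE.
have [t2 [s2 [e2 h2 b2 I2]]] := IH i.+1 s1 mE' iN fr1 I1 b1.
exists (cost s a + bits (eval s a) + t1 + t2), s2; split=> //.
  exact: exec_while_loop e1 e2.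
apply: leq_trans (leq_add (leq_add (light_cost sW la) h1) h2) _.
by rewrite -mulSn -mulnDl leq_mul2r; apply/orP; right; lia.
Qed.

End Run.

(** * Covers of the modulator *)

Section StableSets.
Variables (V : finType) (e : rel V).

Definition stable (S : {set V}) : bool :=
  [forall u in S, forall v in S, ~~ e u v].

Definition num_stable (X : {set V}) : nat :=
  #|[set S : {set V} | stable S & S \subset X]|.

Lemma stableP (S : {set V}) :
  reflect (forall u v, u \in S -> v \in S -> ~~ e u v) (stable S).
Proof.
apply: (iffP forall_inP) => [h u v uS vS|h u uS];
  first by have /forall_inP := h u uS; apply.
by apply/forall_inP => v; apply: h.
Qed.

Lemma stableS (S S' : {set V}) : S' \subset S -> stable S -> stable S'.
Proof.
by move=> /subsetP sub /stableP st; apply/stableP => u v /sub uS /sub; apply: st.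
Qed.

Lemma num_stable_leq X : num_stable X <= 2 ^ #|V|.
Proof.
apply: leq_trans (_ : #|[set: {set V}]| <= _); first exact/subset_leq_card/subsetT.
by rewrite -powersetT card_powerset cardsT.
Qed.

Lemma num_stable0 : num_stable set0 = 1.
Proof.
rewrite /num_stable (_ : [set _ | _ & _] = [set set0]) ?cards1 //.
apply/setP => S; rewrite !inE subset0; case: eqP => [->|]; rewrite ?andbF ?andbT //.
by apply/stableP => u v; rewrite inE.
Qed.

Lemma num_stable_setU1 v (X : {set V}) : simple_graph e -> v \notin X ->
  num_stable (v |: X) = num_stable X + num_stable (X :\: closed_nbh e v).
Proof.
move=> [esym eirr] vX; rewrite /num_stable.
rewrite -(cardsID [set S : {set V} | v \notin S]); congr (_ + _).
  apply: eq_card => S; rewrite !inE -andbA; congr (_ && _).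
  apply/andP/idP => [[/subsetP sub vS]|sub].
    apply/subsetP => u uS; have := sub u uS; rewrite !inE => /orP[/eqP uv|//].
    by rewrite -uv uS in vS.
  by split; [apply: subset_trans sub (subsetUr _ _)|apply: contraNN vX; apply/subsetP].
rewrite -[RHS](card_in_imset (f := fun S => v |: S)); last first.
  move=> S S'; rewrite !inE => /andP[_ h] /andP[_ h'] eqS.
  have notv (T : {set V}) : T \subset X :\: closed_nbh e v -> v \notin T.
    by move=> /subsetP sub; apply/negP => /sub; rewrite !inE eqxx.
  by rewrite -(setU1K (notv S h)) eqS setU1K ?notv.
apply: eq_card => S; rewrite !inE negbK; apply/andP/imsetP.
  move=> [vS /andP[st sub]]; exists (S :\ v); last by rewrite setD1K.
  rewrite inE (stableS (subsetDl _ _) st) /=; apply/subsetP => u;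
    rewrite !inE => /andP[uv uS].
  have := subsetP sub u uS; rewrite !inE (negbTE uv) /= => ->; rewrite andbT.
  by move/stableP: st; apply.
move=> [T]; rewrite inE => /andP[/stableP st /subsetP sub] ->; split;
  first by rewrite !inE eqxx.
apply/andP; split; last first.
  by apply/subsetP => u; rewrite !inE => /orP[->//|/sub];
    rewrite !inE => /andP[_ ->]; rewrite orbT.
have nv u : u \in T -> ~~ e v u by move/sub; rewrite !inE negb_or => /andP[/andP[]].
apply/stableP => u w; rewrite !inE => /orP[/eqP->|uT] /orP[/eqP->|wT].
- by rewrite eirr.
- exact: nv.
- by rewrite esym nv.
- exact: st.
Qed.

End StableSets.

Lemma nth_allpairs (T1 T2 T : Type) (f : T1 -> T2 -> T) x1 x2 x s t i j :
  i < size s -> j < size t ->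
  nth x [seq f y z | y <- s, z <- t] (i * size t + j) = f (nth x1 s i) (nth x2 t j).
Proof.
move=> + lt_j; elim: s i => // y s IH [|i] lt_i /=.
  by rewrite mul0n nth_cat size_map lt_j (nth_map x2).
by rewrite nth_cat size_map mulSn -addnA ltnNge leq_addr /= addKn IH.
Qed.

Lemma card_pairs (T U : finType) (P : U -> pred T) :
  #|[set p : T * U | P p.2 p.1]| = \sum_w #|[set x | P w x]|.
Proof.
rewrite -sum1dep_card big_mkcond /=.
rewrite -(pair_bigA _ (fun x w => if P w x then 1 else 0)) exchange_big.
by apply: eq_bigr => w _; rewrite -big_mkcond sum1dep_card.
Qed.

Lemma Posz_card (T : finType) (P : pred T) :
  (Posz #|[set x | P x]| = \sum_x (P x)%:Z)%R.
Proof.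
rewrite -sum1dep_card big_mkcond (big_morph Posz PoszD (erefl _)).
by apply: eq_bigr => x _; case: ifP.
Qed.

Section Covers.
Variables (V : finType) (e : rel V) (M Q : {set V}).
Hypothesis e_simple : simple_graph e.
Hypothesis M_mod : clique_modulator e M.

(** Vertices outside [M] own the class that contains them, vertices in [Q] own
    an additional class inside [M], and the remaining vertices own an empty
    class.  [p.1] is the trace of the class on [M] and [p.2] dominates it. *)
Definition slot (v : V) (p : {set V} * V) : bool :=
  if v \in M then
    if v \in Q then stable e p.1 && (p.1 \subset closed_nbh e p.2)
    else p == (set0, v)
  else [&& stable e p.1, p.1 \subset closed_nbh e p.2,
           v \in closed_nbh e p.2 & p.1 \subset ~: closed_nbh e v].

Definition num_slot (v : V) (X : {set V}) : nat :=
  #|[set p | slot v p & p.1 \subset X]|.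

Definition slot_sign (v : V) (X : {set V}) : int :=
  (if (v \in M) && (v \notin X) then -1 else 1)%R.

Definition slot_sum : int :=
  (\sum_(X in powerset M) \prod_v (slot_sign v X * (num_slot v X)%:Z))%R.

Lemma sum_slot_sign (U : {set V}) :
  (\sum_(X in powerset M) \prod_v slot_sign v X * (U \subset X)%:Z =
   (U == M)%:Z)%R.
Proof.
pose F v : int := ((v \in M)%:Z)%R.
pose G v : int := (if v \in M then - (v \notin U)%:Z else (v \notin U)%:Z)%R.
have -> : ((U == M)%:Z = \prod_v (F v + G v))%R.
  have [UM|UM] := eqVneq U M.
    by rewrite big1 // => v _; rewrite /F /G UM; case: (v \in M).
  have [v vUM] : exists v, (v \in U) != (v \in M).
    apply/existsP; apply: contraNT UM; rewrite negb_exists => /forallP h.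
    by apply/eqP/setP => v; apply/eqP; have := h v; rewrite negbK.
  by rewrite (bigD1 v) //= /F /G; case: (v \in M) vUM; case: (v \in U) => //= _;
    rewrite mul0r.
rewrite bigA_distr [RHS](bigID (fun X => X \in powerset M)) /= [X in (_ + X)%R]big1 ?addr0.
  apply: eq_bigr => X; rewrite inE => XM; have [UX|UX] := boolP (U \subset X).
    rewrite mulr1; apply: eq_bigr => v _; rewrite /slot_sign /F /G.
    have [vX|vX] := boolP (v \in X); first by rewrite (subsetP XM v vX).
    by rewrite (contraNN (subsetP UX v) vX); case: (v \in M).
  have /subsetPn[v vU vX] := UX.
  by rewrite mulr0 (bigD1 v) //= (negbTE vX) /G vU oppr0; case: ifP; rewrite mul0r.
move=> X; rewrite inE => /subsetPn[v vX vM].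
by rewrite (bigD1 v) //= vX /F (negbTE vM) mul0r.
Qed.

Lemma slot_sumE :
  slot_sum = #|[set f : {ffun V -> {set V} * V} | [forall v, slot v (f v)] &
                 \bigcup_v (f v).1 == M]|.
Proof.
rewrite /slot_sum.
have numE X : (\prod_v (slot_sign v X * (num_slot v X)%:Z) =
    \sum_(f : {ffun V -> {set V} * V} | [forall v, slot v (f v)])
       \prod_v slot_sign v X * (\bigcup_v (f v).1 \subset X)%:Z)%R.
  rewrite big_split /= -mulr_sumr; congr (_ * _)%R.
  have -> : (\prod_v (num_slot v X)%:Z = \prod_v \sum_p (slot v p && (p.1 \subset X))%:Z)%R.
    by apply: eq_bigr => v _; rewrite /num_slot Posz_card.
  rewrite bigA_distr_bigA [RHS]big_mkcond /=; apply: eq_bigr => f _.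
  have [/forallP sl|] := boolP [forall v, slot v (f v)]; last first.
    by rewrite negb_forall => /existsP[v /negbTE nv]; rewrite (bigD1 v) //= nv mul0r.
  have [/bigcupsP sub|/subsetPn[u /bigcupP[v _ uv] uX]] := boolP (\bigcup_v (f v).1 \subset X).
    by rewrite big1 // => v _; rewrite sl sub.
  rewrite (bigD1 v) //= sl; case: subsetP => [/(_ u uv)|]; last by rewrite mul0r.
  by rewrite (negbTE uX).
under eq_bigr => X _ do rewrite numE.
rewrite exchange_big /=; under eq_bigr => f _ do rewrite sum_slot_sign.
rewrite Posz_card big_mkcond; apply: eq_bigr => f _ /=.
by case: ifP.
Qed.

Lemma slot_sum_gt0 :
  (0 < slot_sum)%R <->
  exists f : V -> {set V} * V,
    (forall v, slot v (f v)) /\ \bigcup_v (f v).1 = M.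
Proof.
rewrite slot_sumE ltz_nat.
split=> [/card_gt0P[f]|[f [sl UM]]].
  by rewrite inE => /andP[/forallP sl /eqP UM]; exists f.
apply/card_gt0P; exists (finfun f); rewrite inE; apply/andP; split.
  by apply/forallP => v; rewrite ffunE.
by apply/eqP; rewrite -UM; apply: eq_bigr => v _; rewrite ffunE.
Qed.

Hypothesis QM : Q \subset M.

Lemma slots_coloring (l : int) (f : V -> {set V} * V) :
  (forall v, slot v (f v)) -> \bigcup_v (f v).1 = M ->
  (Posz (#|~: M| + #|Q|) <= l)%R -> has_CD_coloring e l.
Proof.
move=> sl UM lM; have [esym eirr] := e_simple.
pose chi u := if u \in M then odflt u [pick v | u \in (f v).1] else u.
have chiM u : u \in M -> u \in (f (chi u)).1.
  move=> uM; rewrite /chi uM; case: pickP => //= none.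
  by move: uM; rewrite -UM => /bigcupP[v _]; rewrite none.
have chiK u : u \notin M -> chi u = u by rewrite /chi => /negbTE->.
have chiKQ u : chi u \in ~: M :|: Q.
  have [uM|uM] := boolP (u \in M); last by rewrite chiK // !inE uM.
  rewrite !inE; case: (boolP (chi u \in M)) => //= vM.
  have := chiM u uM; have := sl (chi u); rewrite /slot vM.
  by case: (chi u \in Q) => // /eqP->; rewrite inE.
exists V, chi; split; last first.
  apply: le_trans lM; rewrite lez_nat /num_colors -cardsUI.
  apply: leq_trans (leq_addr _ _); apply/subset_leq_card/subsetP => c /codomP[u ->];
    exact: chiKQ.
have stab v : stable e (f v).1.
  have := sl v; rewrite /slot; case: ifP => _; last by case/and4P.
  case: ifP => [_ /andP[] //|_ /eqP->]; by apply/stableP => u w; rewrite inE.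
have KM u v : u \in M -> v \notin M -> chi u = v -> e u v -> False.
  move=> uM vM uv euv; have := chiM u uM; rewrite uv.
  have := sl v; rewrite /slot (negbTE vM) => /and4P[_ _ _ /subsetP sub] /sub.
  by rewrite !inE -(esym u) euv orbT.
split.
  move=> u v euv; apply/eqP => uv.
  have [uM|uM] := boolP (u \in M); have [vM|vM] := boolP (v \in M).
  - have := chiM u uM; have := chiM v vM; rewrite uv => vS uS.
    by have /stableP/(_ u v uS vS) := stab (chi v); rewrite euv.
  - by apply: (KM u v) => //; rewrite uv chiK.
  - by apply: (KM v u) => //; rewrite -?uv ?chiK // esym.
  - by move: euv; rewrite -(chiK u uM) uv chiK // eirr.
move=> c /codomP[u0 c0]; exists (f c).2.
have sub : (f c).1 \subset closed_nbh e (f c).2.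
  have := sl c; rewrite /slot; case: ifP => _; last by case/and4P.
  case: ifP => [_ /andP[] //|_ /eqP->]; exact: sub0set.
apply/subsetP => u; rewrite inE => /eqP uc.
have [uM|uM] := boolP (u \in M).
  by apply: (subsetP sub); rewrite -uc chiM.
have cu : c = u by rewrite -uc chiK.
by have := sl c; rewrite /slot cu (negbTE uM) => /and4P[].
Qed.

Lemma coloring_slots (l : int) :
  (#|Q| = #|M| \/ l <= Posz (#|~: M| + #|Q|))%R ->
  has_CD_coloring e l ->
  (Posz #|~: M| <= l)%R /\
  exists f : V -> {set V} * V,
    (forall v, slot v (f v)) /\ \bigcup_v (f v).1 = M.
Proof.
move=> hQ [C [chi [[prop dom] nl]]]; have [esym eirr] := e_simple.
have injK : {in ~: M &, injective chi}.
  move=> u v uK vK uv; apply/eqP; apply: contraT => neq.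
  by have := prop u v (M_mod uK vK neq); rewrite uv eqxx.
pose CK := [set chi u | u in ~: M].
pose C0 := [set c in codom chi] :\: CK.
have cardC : #|CK| + #|C0| = num_colors chi.
  have -> : num_colors chi = #|[set c in codom chi]| by rewrite cardsE.
  rewrite -[RHS](cardsID CK); congr (_ + _); apply: eq_card => c; rewrite inE.
  rewrite andb_idl // => /imsetP[u _ ->]; by rewrite inE codom_f.
have cardK : #|CK| = #|~: M| by rewrite card_in_imset.
split; first by apply: le_trans nl; rewrite lez_nat -cardC cardK leq_addr.
have C0M : C0 \subset [set chi u | u in M].
  apply/subsetP => c; rewrite !inE => /andP[cK /codomP[u cu]]; apply/imsetP;
    exists u => //.
  by apply: contraNT cK => uM; rewrite cu; apply: imset_f; rewrite inE.
have C0Q : #|C0| <= #|Q|.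
  case: hQ => [->|hl];
    first by apply: leq_trans (subset_leq_card C0M) (leq_imset_card _ _).
  by have := le_trans nl hl; rewrite lez_nat -cardC cardK leq_add2l.
pose w v c := odflt v [pick x | dominates e x (color_class chi c)].
have wP v c : c \in codom chi -> color_class chi c \subset closed_nbh e (w v c).
  by move=> /dom[x xc]; rewrite /w; case: pickP => [//|none]; rewrite none in xc.
have stab c : stable e (color_class chi c).
  apply/stableP => u v; rewrite !inE => /eqP uc /eqP vc; apply/negP => /prop.
  by rewrite uc vc eqxx.
have C0cod c : c \in C0 -> c \in codom chi by rewrite !inE => /andP[].
pose g v := nth None (map Some (enum C0)) (index v (enum Q)).
have gC0 v c : g v = Some c -> c \in C0.
  rewrite /g; have [lt|ge] := ltnP (index v (enum Q)) (size (enum C0)).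
    by rewrite (nth_map c) // => -[<-]; rewrite -mem_enum mem_nth.
  by rewrite nth_default // size_map.
have g_onto c : c \in C0 -> exists2 v, v \in Q & g v = Some c.
  move=> cC0; have cC0' : c \in enum C0 by rewrite mem_enum.
  have ltQ : index c (enum C0) < #|Q|.
    by apply: leq_trans C0Q; rewrite cardE index_mem.
  exists (enum_val (Ordinal ltQ)); first exact: enum_valP.
  rewrite /g /enum_val index_uniq ?enum_uniq -?cardE // (nth_map c) ?index_mem //.
  by rewrite nth_index.
pose f v := if v \in M then
    if v \in Q then
      if g v is Some c then (color_class chi c, w v c) else (set0, v)
    else (set0, v)
  else (color_class chi (chi v) :&: M, w v (chi v)).
have st0 : stable e set0 by apply/stableP => u v; rewrite inE.
exists f; split.
  move=> v; rewrite /slot /f; case: (boolP (v \in M)) => vM.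
    case: (boolP (v \in Q)) => vQ; last exact: eqxx.
    case gv: (g v) => [c|] /=; last by rewrite st0 sub0set.
    by rewrite stab wP // C0cod // (gC0 v).
  rewrite /= (stableS (subsetIl _ _) (stab _)) /=.
  have sub := wP v (chi v) (codom_f _ _); apply/and3P; split.
  - exact: subset_trans (subsetIl _ _) sub.
  - by apply: (subsetP sub); rewrite inE.
  - apply/subsetP => u; rewrite !inE => /andP[/eqP uv uM]; rewrite negb_or.
    apply/andP; split; first by apply: contraNneq vM => <-.
    by apply/negP => /prop; rewrite uv eqxx.
apply/setP => u; apply/bigcupP/idP => [[v _]|uM].
  rewrite /f; case: ifP => vM; last by rewrite inE => /andP[].
  case: ifP => _; last by rewrite inE.
  case gv: (g v) => [c|]; last by rewrite inE.
  rewrite inE => /eqP uc; have := gC0 v c gv; rewrite !inE => /andP[cK _].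
  by apply: contraNT cK => uM; rewrite -uc; apply: imset_f; rewrite inE.
have [/imsetP[v]|uK] := boolP (chi u \in CK).
  rewrite inE => vM uv; exists v => //; rewrite /f (negbTE vM) !inE uv eqxx uM //.
have [|v vQ gv] := g_onto (chi u); first by rewrite inE uK inE codom_f.
by exists v => //; rewrite /f (subsetP QM) // vQ gv inE.
Qed.

End Covers.

(** * Encoding of vertex sets *)

Definition bitsum (b : nat -> bool) (i : nat) : nat := \sum_(u < i) b u * 2 ^ u.

Lemma bitsumS b i : bitsum b i.+1 = bitsum b i + b i * 2 ^ i.
Proof. by rewrite /bitsum big_ord_recr. Qed.

Lemma bitsum_lt b i : bitsum b i < 2 ^ i.
Proof.
elim: i => [|i IH]; first by rewrite /bitsum big_ord0.
by rewrite bitsumS expnS; case: (b i); lia.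
Qed.

Lemma bitsum_bit b i u : u < i -> odd (bitsum b i %/ 2 ^ u) = b u.
Proof.
move=> ui.
have [h ->] : exists h, bitsum b i = bitsum b u.+1 + 2 ^ u.+1 * h.
  elim: i ui => // i IH; rewrite ltnS leq_eqVlt => /orP[/eqP->|ui].
    by exists 0; rewrite muln0 addn0.
  have [h ih] := IH ui; exists (h + b i * 2 ^ (i - u.+1)).
  by rewrite bitsumS ih mulnDr mulnCA -expnD subnKC // addnA.
rewrite bitsumS (_ : _ + _ = (b u + h.*2) * 2 ^ u + bitsum b u);
  last by rewrite expnS; lia.
by rewrite divnMDl ?expn_gt0 // divn_small ?bitsum_lt // addn0 oddD odd_double addbF oddb.
Qed.

Section Masks.
Variable n : nat.

Definition mem_nat (X : {set 'I_n}) (i : nat) : bool :=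
  if insub i is Some u then u \in X else false.

Lemma mem_natE X (u : 'I_n) : mem_nat X u = (u \in X).
Proof. by rewrite /mem_nat valK. Qed.

Lemma mem_natI X Y i : mem_nat (X :&: Y) i = mem_nat X i && mem_nat Y i.
Proof. by rewrite /mem_nat; case: insubP => // u _ _; rewrite inE. Qed.

Lemma mem_natD X Y i : mem_nat (X :\: Y) i = mem_nat X i && ~~ mem_nat Y i.
Proof. by rewrite /mem_nat; case: insubP => // u _ _; rewrite inE andbC. Qed.

Definition encset (X : {set 'I_n}) : nat := \sum_(u in X) 2 ^ u.

Lemma encset_bitsum X : encset X = bitsum (mem_nat X) n.
Proof.
rewrite /encset /bitsum big_mkcond; apply: eq_bigr => u _.
by rewrite mem_natE; case: (u \in X); rewrite ?mul1n.
Qed.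

Lemma encset_lt X : encset X < 2 ^ n.
Proof. by rewrite encset_bitsum bitsum_lt. Qed.

Lemma encset_inj : injective encset.
Proof.
move=> X Y; rewrite !encset_bitsum => XY; apply/setP => u.
by rewrite -!mem_natE -(@bitsum_bit _ n) // XY bitsum_bit.
Qed.

Lemma encsetU1 v (X : {set 'I_n}) : v \notin X -> encset (v |: X) = encset X + 2 ^ v.
Proof. by move=> vX; rewrite /encset big_setU1 //= addnC. Qed.

Lemma encset0 : encset set0 = 0.
Proof. by rewrite /encset big_set0. Qed.

Variable M : {set 'I_n}.

(** Enumerates the subsets of [M] below [i] by doubling, in the order in which
    the program writes their codes into memory. *)
Fixpoint sublist (i : nat) : seq {set 'I_n} :=
  if i is j.+1 then
    if insub j is Some v then
      if v \in M then sublist j ++ [seq v |: X | X <- sublist j] else sublist j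
    else sublist j
  else [:: set0].

Lemma sublistS (v : 'I_n) :
  sublist v.+1 = if v \in M then sublist v ++ [seq v |: X | X <- sublist v]
                 else sublist v.
Proof. by rewrite /= valK. Qed.

Lemma mem_sublist i (X : {set 'I_n}) : i <= n ->
  (X \in sublist i) = (X \subset [set u in M | u < i]).
Proof.
elim: i X => [|i IH] X lt_in.
  rewrite inE (_ : [set _ in _ | _] = set0) ?subset0 //.
  by apply/setP => u; rewrite !inE ltn0 andbF.
pose v := Ordinal lt_in; rewrite (sublistS v) /=.
have IH' Y : (Y \in sublist i) = (Y \subset [set u in M | u < i]) by apply/IH/ltnW.
have ltS (u : 'I_n) : (u < i.+1) = (u == v) || (u < i) by rewrite ltnS leq_eqVlt.
case: ifPn => vM; last first.
  rewrite IH' (_ : [set u in M | u < i.+1] = [set u in M | u < i]) //.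
  apply/setP => u; rewrite !inE ltS.
  by case: eqP => // ->; rewrite (negbTE vM).
rewrite mem_cat IH'; apply/orP/idP => [[sub|/mapP[Y]]|sub].
- by apply: (subset_trans sub); apply/subsetP => u; rewrite !inE ltS => /andP[-> ->];
    rewrite orbT.
- rewrite IH' => /subsetP sub ->; apply/subsetP => u; rewrite !inE ltS.
  by move=> /orP[/eqP->|/sub]; [rewrite vM eqxx|rewrite !inE => /andP[-> ->];
    rewrite orbT].
- have [vX|vX] := boolP (v \in X); [right|left].
    apply/mapP; exists (X :\ v); last by rewrite setD1K.
    rewrite IH'; apply/subsetP => u; rewrite !inE => /andP[uv uX].
    by have := subsetP sub u uX; rewrite !inE ltS (negbTE uv).
  apply/subsetP => u uX; have := subsetP sub u uX; rewrite !inE ltS.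
  by case: eqP => //= uv; rewrite -uv uX in vX.
Qed.

Lemma sublist_notin (v : 'I_n) (X : {set 'I_n}) : X \in sublist v -> v \notin X.
Proof.
rewrite mem_sublist; last exact: ltnW.
by move=> /subsetP sub; apply/negP => /sub; rewrite !inE ltnn andbF.
Qed.

Lemma sublist_sub i (X : {set 'I_n}) : i <= n -> X \in sublist i -> X \subset M.
Proof.
move=> lt_in; rewrite mem_sublist // => sub; apply: subset_trans sub _.
by apply/subsetP => u; rewrite inE => /andP[].
Qed.

Lemma sublist_down i (X Y : {set 'I_n}) : i <= n -> Y \subset X -> X \in sublist i -> Y \in sublist i.
Proof. by move=> lt_in YX; rewrite !mem_sublist //; apply: subset_trans. Qed.

Lemma mem_sublistn X : (X \in sublist n) = (X \in powerset M).
Proof.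
rewrite mem_sublist // inE (_ : [set u in M | u < n] = M) //; apply/setP => u.
by rewrite inE ltn_ord andbT.
Qed.

Lemma uniq_sublist i : i <= n -> uniq (sublist i).
Proof.
elim: i => // i IH lt_in; rewrite (sublistS (Ordinal lt_in)); set v := Ordinal lt_in.
have un : uniq (sublist v) by apply/IH/ltnW.
case: ifP => // _; rewrite cat_uniq un /= map_inj_in_uniq ?un ?andbT.
  apply/hasPn => _ /mapP[Y _ ->]; apply/negP => /(@sublist_notin v).
  by rewrite setU11.
move=> X Y Xi Yi eqXY; have vX := @sublist_notin v X Xi;
  have vY := @sublist_notin v Y Yi.
by rewrite -(setU1K vX) eqXY setU1K.
Qed.

Lemma size_sublist i : i <= n -> size (sublist i) <= 2 ^ #|M|.
Proof.
move=> lt_in; rewrite -card_powerset cardE; apply: uniq_leq_size;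
  first exact: uniq_sublist.
by move=> X /(sublist_sub lt_in) XM; rewrite mem_enum inE.
Qed.

Lemma sum_sublist (F : {set 'I_n} -> int) :
  (\sum_(X <- sublist n) F X = \sum_(X in powerset M) F X)%R.
Proof.
rewrite -big_enum /=; apply: perm_big; apply: uniq_perm;
  rewrite ?enum_uniq ?uniq_sublist //.
by move=> X; rewrite mem_enum mem_sublistn.
Qed.

End Masks.

(** * The program *)

Local Notation rans := 0 (only parsing).
Local Notation rn := 1 (only parsing).
Local Notation rbase := 2 (only parsing).
Local Notation rq := 3 (only parsing).
Local Notation rsz := 4 (only parsing).
Local Notation rv := 5 (only parsing).
Local Notation rp := 6 (only parsing).
Local Notation rj := 7 (only parsing).
Local Notation rX := 8 (only parsing).
Local Notation rR := 9 (only parsing).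
Local Notation ru := 10 (only parsing).
Local Notation rpu := 11 (only parsing).
Local Notation ra := 12 (only parsing).
Local Notation rb := 13 (only parsing).
Local Notation rc := 14 (only parsing).
Local Notation rG := 15 (only parsing).
Local Notation rprod := 16 (only parsing).
Local Notation rr := 17 (only parsing).
Local Notation rsum := 18 (only parsing).

Local Notation "x `+` y" := (Op Add x y) (at level 50, left associativity).
Local Notation "x `-` y" := (Op Defs.Sub x y) (at level 50, left associativity).
Local Notation "x `*` y" := (Op Mul x y) (at level 40, left associativity).
Local Notation "x `/` y" := (Op Div x y) (at level 40, left associativity).
Local Notation "x ::= a" := (Assign x a) (at level 60).
Local Notation "p ;; q" := (Seq p q) (at level 65, right associativity).
Local Notation K z := (Cst (Posz z)).

(** The cells [2 + r * n + u] hold, for [r < n], the closed neighborhood of [r];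
    for [r = n], the modulator, which [encode] already places there; for
    [r = n + 1], the empty set; for [r = n + 2], the full set.  From [base]
    on, even offsets list the codes of the subsets of [M], and the odd offset
    [2 * x + 1] holds the number of stable subsets of the set with code [x]. *)
Definition entry (r u : nat) : expr := Fetch (K 2 `+` Reg r `*` Reg rn `+` Reg u).

Definition bit (x p : nat) : expr :=
  Reg x `/` Reg p `-` K 2 `*` (Reg x `/` (Reg p `+` Reg p)).

Definition list_addr (j : expr) : expr := Reg rbase `+` K 2 `*` j.

Definition table_addr (x : expr) : expr := Reg rbase `+` K 2 `*` x `+` K 1.

(** Sets [rR] to the code of the set in [rX], intersected with row [ra] and
    without row [rb]. *)
Definition restrict_body : cmd :=
  rR ::= Reg rR `+` Reg rpu `*` (bit rX rpu `*` (entry ra ru `*` (K 1 `-` entry rb ru))) ;;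
  rpu ::= Reg rpu `+` Reg rpu ;;
  ru ::= Reg ru `+` K 1.

Definition restrict : cmd :=
  rR ::= K 0 ;; ru ::= K 0 ;; rpu ::= K 1 ;;
  While (Reg rn `-` Reg ru) restrict_body.

Definition double_body : cmd :=
  rX ::= Fetch (list_addr (Reg rj)) ;;
  restrict ;;
  Store (list_addr (Reg rsz `+` Reg rj)) (Reg rX `+` Reg rp) ;;
  Store (table_addr (Reg rX `+` Reg rp))
        (Fetch (table_addr (Reg rX)) `+` Fetch (table_addr (Reg rR))) ;;
  rj ::= Reg rj `+` K 1.

Definition table_body : cmd :=
  If (entry rn rv)
     (rb ::= Reg rv ;; rj ::= K 0 ;;
      While (Reg rsz `-` Reg rj) double_body ;;
      rsz ::= Reg rsz `+` Reg rsz)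
     Skip ;;
  rp ::= Reg rp `+` Reg rp ;;
  rv ::= Reg rv `+` K 1.

Definition fill_table : cmd :=
  Store (Reg rbase) (K 0) ;; Store (Reg rbase `+` K 1) (K 1) ;;
  rsz ::= K 1 ;; rv ::= K 0 ;; rp ::= K 1 ;; ra ::= Reg rn ;;
  While (Reg rn `-` Reg rv) table_body.

Definition count_body : cmd :=
  restrict ;;
  rG ::= Reg rG `+` entry rc ra `*` Fetch (table_addr (Reg rR)) ;;
  ra ::= Reg ra `+` K 1.

Definition count_slot : cmd :=
  ra ::= K 0 ;; While (Reg rn `-` Reg ra) count_body.

Definition select_slot : cmd :=
  If (entry rn rv)
     (If (bit rX rp) Skip (rprod ::= K 0 `-` Reg rprod) ;;
      rb ::= Reg rn `+` K 1 ;;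
      If (Reg rr) (rc ::= Reg rn `+` K 2 ;; rG ::= K 0)
                  (rc ::= Reg rn `+` K 1 ;; rG ::= K 1) ;;
      rr ::= Reg rr `-` K 1)
     (rb ::= Reg rv ;; rc ::= Reg rv ;; rG ::= K 0).

Definition product_body : cmd :=
  select_slot ;;
  count_slot ;;
  rprod ::= Reg rprod `*` Reg rG ;;
  rp ::= Reg rp `+` Reg rp ;;
  rv ::= Reg rv `+` K 1.

Definition sum_body : cmd :=
  rX ::= Fetch (list_addr (Reg rj)) ;;
  rprod ::= K 1 ;; rr ::= Reg rq ;; rv ::= K 0 ;; rp ::= K 1 ;;
  While (Reg rn `-` Reg rv) product_body ;;
  rsum ::= Reg rsum `+` Reg rprod ;;
  rj ::= Reg rj `+` K 1.

Definition sum_products : cmd :=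
  rsum ::= K 0 ;; rj ::= K 0 ;; While (Reg rsz `-` Reg rj) sum_body.

Definition prepare_body : cmd :=
  Store (K 2 `+` Reg ru `*` Reg rn `+` Reg ru) (K 1) ;;
  Store (K 2 `+` (Reg rn `+` K 2) `*` Reg rn `+` Reg ru) (K 1) ;;
  rq ::= Reg rq `-` K 1 `+` entry rn ru ;;
  ru ::= Reg ru `+` K 1.

Definition prepare : cmd :=
  rn ::= Fetch (K 0) ;;
  rbase ::= K 2 `+` (Reg rn `+` K 3) `*` Reg rn ;;
  rq ::= Fetch (K 1) ;;
  ru ::= K 0 ;;
  While (Reg rn `-` Reg ru) prepare_body.

Definition answer : cmd :=
  If (Reg rq `+` K 1) (If (Reg rsum) (rans ::= K 1) (rans ::= K 0)) (rans ::= K 0).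

Definition cd_program : cmd := prepare ;; fill_table ;; sum_products ;; answer.

(** * Correctness *)

Section Correctness.
Variables (n : nat) (e : rel 'I_n) (l : int) (M : {set 'I_n}).
Hypothesis e_simple : simple_graph e.

Definition nbh_row (r : nat) : {set 'I_n} :=
  if insub r is Some v then closed_nbh e v
  else if r == n then M else if r == n.+2 then setT else set0.

Lemma row_ord (v : 'I_n) : nbh_row v = closed_nbh e v.
Proof. by rewrite /nbh_row valK. Qed.

Lemma row_mod : nbh_row n = M.
Proof. by rewrite /nbh_row insubN ?ltnn // eqxx. Qed.

Lemma row_empty : nbh_row n.+1 = set0.
Proof. by rewrite /nbh_row insubN -?leqNgt // !ifN //; lia. Qed.

Lemma row_full : nbh_row n.+2 = setT.
Proof. by rewrite /nbh_row insubN -?leqNgt ?leqW // ifN ?eqxx //; lia. Qed.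

Definition rows_ok (c : nat -> int) : Prop :=
  forall r k, r < n + 3 -> k < n -> c (2 + r * n + k) = mem_nat (nbh_row r) k.

Definition base : nat := 2 + (n + 3) * n.

Definition max_count : nat := (n * 2 ^ n).+1.

(** Exceeds every value that the program stores; the last two summands account
    for the counts, the products over slots and their sum. *)
Definition cap : nat :=
  n * n + 5 * n + 10 + `|l| + 2 * 2 ^ n + max_count + 2 ^ n * max_count ^ n.

Variable W : nat.
Hypothesis cap_lt : cap < 2 ^ W.

Lemma W_gt0 : 0 < W.
Proof. by move: cap_lt; rewrite /cap; case: W => //; rewrite expn0; lia. Qed.

Lemma eval_entry s r u i k :
  regs s rn = n -> regs s r = Posz i -> regs s u = Posz k ->
  rows_ok (cells s) -> i < n + 3 -> k < n ->
  eval s (entry r u) = mem_nat (nbh_row i) k.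
Proof.
by move=> hn hr hu rows lt_i lt_k; rewrite /= hn hr hu -(rows i k) //.
Qed.

Lemma eval_bit s x p b i k :
  regs s x = bitsum b i -> regs s p = Posz (2 ^ k) -> k < i ->
  eval s (bit x p) = b k.
Proof.
move=> hx hp ki; rewrite /= hx hp -(bitsum_bit b ki) -PoszD addnn -muln2 !divz_nat divnMA divn2.
by move: (bitsum b i %/ 2 ^ k) => m; have := odd_double_half m; lia.
Qed.

Lemma lt_small i : i <= n * n + 5 * n + 10 -> i < 2 ^ W.
Proof. by move=> h; apply: leq_ltn_trans cap_lt; rewrite /cap; lia. Qed.

Lemma lt_double i : i <= 2 * 2 ^ n -> i < 2 ^ W.
Proof. by move=> h; apply: leq_ltn_trans cap_lt; rewrite /cap; lia. Qed.

Lemma lt_index i : i <= n + 3 -> i < 2 ^ W.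
Proof. by move=> h; apply: lt_small; lia. Qed.

Lemma lt_const i : i <= 10 -> i < 2 ^ W.
Proof. by move=> h; apply: lt_small; rewrite (leq_trans h) // leq_addl. Qed.

Lemma test_gt0 (N i : nat) : (0 < Posz N - Posz i)%R = (i < N).
Proof. by rewrite subr_gt0 ltz_nat. Qed.

Lemma run_restrict s (X : {set 'I_n}) i k :
  regs s rn = n -> rows_ok (cells s) -> regs s rX = encset X ->
  regs s ra = Posz i -> regs s rb = Posz k -> i < n + 3 -> k < n + 3 ->
  run W restrict s (4 * n + 4)
      (fun s' => regs s' rR = encset (X :&: nbh_row i :\: nbh_row k)).
Proof.
move=> hn rows hX ha hb lt_i lt_k; have W0 := W_gt0.
set Y := X :&: nbh_row i :\: nbh_row k.
pose I j (s' : state) := [/\ regs s' rR = bitsum (mem_nat Y) j,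
  regs s' rpu = Posz (2 ^ j) & regs s' ru = j].
eapply run_conseq; first do 3 (apply: run_seq; apply: run_assign => //=;
  first by move=> _; exact: lt_const).
- apply: (run_for W0 (I := I) (N := n)) => //.
  + by split=> //=; rewrite /bitsum big_ord0.
  + move=> j s' lt_jn [fr fc] [hR hpu hu]; split;
      first by rewrite /= hu fr //= hn test_gt0.
    have hn' : regs s' rn = n by rewrite fr.
    have rows' : rows_ok (cells s') by rewrite fc.
    have /= ea : eval s' (entry ra ru) = mem_nat (nbh_row i) j.
      by apply: eval_entry => //; rewrite fr.
    have /= eb : eval s' (entry rb ru) = mem_nat (nbh_row k) j.
      by apply: eval_entry => //; rewrite fr.
    have /= ebit : eval s' (bit rX rpu) = mem_nat X j.
      by apply: eval_bit hpu lt_jn; rewrite fr //= hX encset_bitsum.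
    have b_lt := bitsum_lt (mem_nat Y) j.+1.
    have pow : 2 ^ j.+1 <= 2 ^ n by rewrite leq_exp2l.
    have val : (regs s' rR + regs s' rpu * ((mem_nat X j)%:Z * ((mem_nat (nbh_row i) j)%:Z *
        (1 - (mem_nat (nbh_row k) j)%:Z))) = bitsum (mem_nat Y) j.+1)%R.
      rewrite hR hpu bitsumS mem_natD mem_natI PoszD PoszM.
      by case: (mem_nat X j); case: (mem_nat (nbh_row i) j);
        case: (mem_nat (nbh_row k) j);
        rewrite ?mul0r ?mul1r ?mulr0 ?subrr ?subr0 ?mulr1 ?mulr0.
    apply: run_seq; apply: run_assign => //=; first rewrite ebit ea eb val => _.
      by apply: lt_double;
        rewrite (leq_trans (ltnW b_lt)) // (leq_trans pow) // leq_pmull.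
    rewrite ebit ea eb val.
    apply: run_seq; apply: run_assign => //=.
      by rewrite hpu -PoszD addnn -mul2n -expnS => _; apply: lt_double;
        rewrite (leq_trans pow) // leq_pmull.
    apply: run_assign => //=; first by rewrite hu -PoszD addn1 => _; apply: lt_index;
      rewrite ltn_addr.
    by split=> //=; rewrite ?hpu ?hu -PoszD ?addn1 // addnn -mul2n -expnS.
  + by move=> s' [fr _] [_ _ hu]; rewrite /= hu fr //= hn test_gt0 ltnn.
- by clear; lia.
- by move=> s' _ [-> _ _]; rewrite encset_bitsum.
Qed.

Definition table_ok (c : nat -> int) (L : seq {set 'I_n}) : Prop :=
  [/\ rows_ok c,
      forall j, j < size L -> c (base + 2 * j) = encset (nth set0 L j) &
      forall X, X \in L -> c (base + 2 * encset X + 1) = num_stable e X].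

Lemma rows_ok_store c a z : rows_ok c -> base <= a ->
  rows_ok (fun b => if b == a then z else c b).
Proof.
move=> rows ha r k lt_r lt_k; rewrite ifN ?rows //.
have : r.+1 * n <= (n + 3) * n by rewrite leq_mul2r -(addn1 r) addn1 lt_r orbT.
by move: ha; rewrite /base mulSn; clear -lt_k; lia.
Qed.

Lemma table_ok_rcons c L Y : table_ok c L ->
  table_ok (fun b => if b == base + 2 * encset Y + 1 then Posz (num_stable e Y)
                     else if b == base + 2 * size L then Posz (encset Y) else c b)
           (rcons L Y).
Proof.
move=> [rows hl ht]; split.
- by apply: rows_ok_store; [apply: rows_ok_store|]; rewrite // -?addnA leq_addr.
- move=> j; rewrite size_rcons ltnS => lt_j.
  rewrite ifN; last by clear; lia.
  rewrite nth_rcons; case: ltnP => [lt|ge].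
    by rewrite ifN ?hl //; move: lt; clear; lia.
  have -> : j = size L by apply/eqP; rewrite eqn_leq lt_j.
  by rewrite !eqxx.
- move=> X; rewrite mem_rcons inE; case: eqP => [->|XY] /= XL; first by rewrite eqxx.
  rewrite ifN; last first.
    rewrite eqn_add2r eqn_add2l eqn_mul2l /=; apply/eqP => /encset_inj //.
  by rewrite ifN ?ht //; clear; lia.
Qed.

Lemma eval_list s a j L : regs s rbase = base -> eval s a = Posz j ->
  j < size L -> table_ok (cells s) L ->
  eval s (Fetch (list_addr a)) = encset (nth set0 L j).
Proof. by move=> hb ha lt_j [_ hl _]; rewrite -hl //= hb ha. Qed.

Lemma eval_table s a X L : regs s rbase = base -> eval s a = encset X ->
  X \in L -> table_ok (cells s) L ->
  eval s (Fetch (table_addr a)) = num_stable e X.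
Proof. by move=> hb ha XL [_ _ ht]; rewrite -ht //= hb ha. Qed.

Lemma encset_small (X : {set 'I_n}) : encset X < 2 ^ W.
Proof. by apply: lt_double; rewrite (leq_trans (ltnW (encset_lt X))) // leq_pmull. Qed.

Lemma num_stable_small (X : {set 'I_n}) : num_stable e X < 2 ^ W.
Proof.
apply: lt_double; apply: leq_trans (num_stable_leq _ _) _.
by rewrite card_ord leq_pmull.
Qed.

Lemma size_sublist_small i : i <= n -> size (sublist M i) <= 2 ^ n.
Proof.
move=> lt_in; apply: leq_trans (size_sublist M lt_in) _.
by rewrite leq_exp2l // -[X in _ <= X](card_ord n) max_card.
Qed.

Lemma run_double (v : 'I_n) s : v \in M ->
  regs s rn = n -> regs s rbase = base -> regs s rsz = size (sublist M v) ->
  regs s rp = Posz (2 ^ v) -> regs s ra = n -> regs s rb = v -> regs s rj = 0 ->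
  table_ok (cells s) (sublist M v) ->
  run W (While (Reg rsz `-` Reg rj) double_body) s
      (2 ^ #|M| * (4 * n + 11)).+1
      (fun s' => table_ok (cells s') (sublist M v.+1)).
Proof.
move=> vM hn hbase hsz hp ha hb hj tab; have W0 := W_gt0.
have lt_vn : v <= n by apply: ltnW.
pose L := sublist M v; pose N := size L.
pose Lj j := L ++ [seq v |: X | X <- take j L].
pose I (j : nat) (s' : state) := regs s' rj = j /\ table_ok (cells s') (Lj j).
eapply run_conseq; first apply: (run_for W0 (I := I) (N := N)) => //.
- by split; rewrite // /Lj take0 cats0.
- move=> j s' lt_j [fr _] [hj' tab'].
  have hn' : regs s' rn = n by rewrite fr.
  have hbase' : regs s' rbase = base by rewrite fr.
  have hsz' : regs s' rsz = N by rewrite fr.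
  have hp' : regs s' rp = Posz (2 ^ v) by rewrite fr.
  have ha' : regs s' ra = n by rewrite fr.
  have hb' : regs s' rb = v by rewrite fr.
  split; first by rewrite /= hsz' hj' test_gt0.
  pose X := nth set0 L j; pose Y := v |: X.
  have XL : X \in L by apply: mem_nth.
  have vX : v \notin X by apply: sublist_notin XL.
  have subL (Z : {set 'I_n}) : Z \subset X -> Z \in Lj j.
    by move=> ZX; rewrite mem_cat (sublist_down lt_vn ZX XL).
  have eX : eval s' (Fetch (list_addr (Reg rj))) = encset X.
    rewrite (eval_list (a := Reg rj) hbase' hj' _ tab'); first by rewrite nth_cat lt_j.
    by rewrite size_cat (leq_trans lt_j) // leq_addr.
  apply: run_seq; apply: run_assign => //; rewrite eX; first by move=> _;
    apply: encset_small.
  apply: run_seq; eapply run_conseq;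
    first apply: (run_restrict (X := X) (i := n) (k := v)) => //=.
  + by have [] := tab'.
  + by rewrite -[X in X < _]addn0 ltn_add2l.
  + by rewrite ltn_addr.
  + exact: leqnn.
  move=> s2 [fr2 fc2]; rewrite row_mod row_ord => hR.
  have XM : X \subset M by apply: sublist_sub XL.
  move: hR; rewrite (setIidPl XM) => hR.
  have tab2 : table_ok (cells s2) (Lj j) by rewrite fc2.
  have hbase2 : regs s2 rbase = base by rewrite fr2.
  have hX2 : regs s2 rX = encset X by rewrite fr2.
  have hp2 : regs s2 rp = Posz (2 ^ v) by rewrite fr2.
  have hsz2 : regs s2 rsz = N by rewrite fr2.
  have hj2 : regs s2 rj = j by rewrite fr2.
  have eY : eval s2 (Reg rX `+` Reg rp) = encset Y by rewrite /= hX2 hp2 encsetU1.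
  have sizeLj : size (Lj j) = N + j.
    by rewrite size_cat size_map size_takel // ltnW.
  apply: run_seq; apply: run_store => //; rewrite eY; first by move=> _;
    apply: encset_small.
  have -> : `|eval s2 (list_addr (Reg rsz `+` Reg rj))| = base + 2 * size (Lj j).
    by rewrite /= hbase2 hsz2 hj2 sizeLj.
  set s3 := set_mem _ _ _.
  have eT : eval s3 (Fetch (table_addr (Reg rX)) `+` Fetch (table_addr (Reg rR))) = num_stable e Y.
    have odd_addr (Z : {set 'I_n}) : Z \in Lj j -> cells s3 (base + 2 * encset Z + 1) = num_stable e Z.
      move=> ZL; have [_ _ <- //] := tab2; rewrite /= ifN //; clear; lia.
    rewrite /Y num_stable_setU1 // PoszD -!odd_addr ?subL ?subsetDl //.
    by rewrite /= hbase2 hX2 hR.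
  apply: run_seq; apply: run_store => //; rewrite eT; first by move=> _;
    apply: num_stable_small.
  have -> : `|eval s3 (table_addr (Reg rX `+` Reg rp))| = base + 2 * encset Y + 1.
    by rewrite /= hbase2 hX2 hp2 /Y encsetU1.
  apply: run_assign => //=; rewrite hj2 -PoszD (addn1 j).
    by move=> _; apply: (@lt_double j.+1);
      rewrite (leq_trans lt_j) // (leq_trans (size_sublist_small lt_vn)) // leq_pmull.
  split=> //=; rewrite /Lj (take_nth set0) // map_rcons -rcons_cat.
  exact: table_ok_rcons.
- by move=> s' [fr _] [hj' _]; rewrite /= hj' fr // hsz test_gt0 ltnn.
- rewrite ltnS leq_mul // ?size_sublist //; clear; lia.
- by move=> s' _ [_]; rewrite /Lj take_size sublistS vM.
Qed.

Lemma table_ok_set0 c : rows_ok c ->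
  table_ok (fun b => if b == base + 1 then Posz 1 else if b == base then Posz 0 else c b)
           [:: set0].
Proof.
move=> rows; have tab0 : table_ok c [::] by split.
by have := table_ok_rcons set0 tab0; rewrite encset0 num_stable0 muln0 addn0.
Qed.

Lemma run_fill_table s :
  regs s rn = n -> regs s rbase = base -> rows_ok (cells s) ->
  run W fill_table s (n.+1 * (2 ^ #|M| * (4 * n + 11) + 20))
      (fun s' => regs s' rsz = size (sublist M n) /\
                 table_ok (cells s') (sublist M n)).
Proof.
move=> hn hbase rows; have W0 := W_gt0.
pose I (i : nat) (s' : state) := [/\ regs s' rsz = size (sublist M i), regs s' rv = i,
  regs s' rp = Posz (2 ^ i) & table_ok (cells s') (sublist M i)].
eapply run_conseq.
- do 2 (apply: run_seq; apply: run_store => //=; first by move=> _; exact: lt_const).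
  do 3 (apply: run_seq; apply: run_assign => //=; first by move=> _; exact: lt_const).
  apply: run_seq; apply: run_assign => //=; rewrite hn; first by move=> _;
    apply: lt_index; rewrite leq_addr.
  apply: (run_for W0 (I := I) (N := n)) => //.
  + by split=> //=; rewrite hbase; apply: table_ok_set0.
  + move=> i s1 lt_in [fr _] [hsz hv hp tab].
    have hn1 : regs s1 rn = n by rewrite fr.
    have hbase1 : regs s1 rbase = base by rewrite fr.
    have ha1 : regs s1 ra = n by rewrite fr.
    have rows1 : rows_ok (cells s1) by have [] := tab.
    split; first by rewrite /= hn1 hv test_gt0.
    pose v := Ordinal lt_in.
    have eM : eval s1 (entry rn rv) = (v \in M).
      rewrite (eval_entry hn1 hn1 hv rows1) // ?row_mod ?(mem_natE M v) //.
      by rewrite -[X in X < _]addn0 ltn_add2l.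
    apply: run_seq; eapply run_conseq with (Q := fun s2 =>
      regs s2 rsz = size (sublist M v.+1) /\ table_ok (cells s2) (sublist M v.+1)).
    * apply: run_if => //; rewrite eM => vM.
        have {}vM : v \in M by move: vM; case: (v \in M).
        apply: run_seq; apply: run_assign => //=; rewrite hv; first by move=> _;
          apply: lt_index; rewrite ltnW ?ltn_addr.
        apply: run_seq; apply: run_assign => //=; first by move=> _; exact: lt_const.
        apply: run_seq; eapply run_conseq; first exact: (run_double (v := v)).
          exact: leqnn.
        move=> s2 [fr2 _] tab2.
        have hsz2 : regs s2 rsz = size (sublist M v) by rewrite fr2.
        have szS : (regs s2 rsz + regs s2 rsz)%R = size (sublist M v.+1).
          by rewrite hsz2 sublistS vM size_cat size_map.
        apply: run_assign => //=; rewrite szS.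
        move=> _; apply: (@lt_double (size (sublist M v.+1))).
        by rewrite (leq_trans (size_sublist_small _)) ?leq_pmull.
      have {}vM : v \notin M by move: vM; case: (v \in M).
      eapply run_conseq; first exact: (run_skip W0 (Q := fun s2 => s2 = s1)).
        by rewrite addnS.
      by move=> _ _ ->; rewrite sublistS (negbTE vM).
    * exact: leqnn.
    move=> s2 [fr2 _] [hsz2 tab2].
    have hp2 : (regs s2 rp + regs s2 rp)%R = Posz (2 ^ i.+1).
      by rewrite fr2 // hp -PoszD addnn -mul2n -expnS.
    have hv2 : regs s2 rv = i by rewrite fr2.
    apply: run_seq; apply: run_assign => //=; rewrite hp2.
      move=> _; apply: (@lt_double (2 ^ i.+1));
        rewrite (@leq_trans (2 ^ n)) ?leq_pmull //.
      by rewrite leq_exp2l.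
    apply: run_assign => //=; rewrite hv2 -PoszD (addn1 i); last by split.
    by move=> _; apply: (@lt_index i.+1); rewrite ltn_addr.
  + by move=> s1 [fr _] [_ hv _ _]; rewrite /= hv fr //= hn test_gt0 ltnn.
- by move: (2 ^ #|M| * _) => m; clear; nia.
- by move=> s' _ [-> _ _ tab].
Qed.

Lemma run_count_slot s (X : {set 'I_n}) k c g :
  regs s rn = n -> regs s rbase = base -> regs s rX = encset X -> X \subset M ->
  regs s rb = Posz k -> regs s rc = Posz c -> k < n + 3 -> c < n + 3 ->
  regs s rG = Posz g -> g <= 1 -> table_ok (cells s) (sublist M n) ->
  run W count_slot s (n * (4 * n + 7) + 2)
      (fun s' => regs s' rG = g + \sum_(w < n)
          mem_nat (nbh_row c) w * num_stable e (X :&: nbh_row w :\: nbh_row k)).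
Proof.
move=> hn hbase hX XM hb hc lt_k lt_c hG g1 tab; have W0 := W_gt0.
pose S (i : nat) := g + \sum_(w < i) mem_nat (nbh_row c) w * num_stable e (X :&: nbh_row w :\: nbh_row k).
have S_leq i : S i <= (i * 2 ^ n).+1.
  rewrite -add1n leq_add // -[X in X * _]card_ord -sum_nat_const leq_sum // => w _.
  rewrite -[X in _ <= X]mul1n leq_mul ?leq_b1 //.
  by apply: leq_trans (num_stable_leq _ _) _; rewrite card_ord.
pose I (i : nat) (s' : state) := regs s' ra = i /\ regs s' rG = S i.
eapply run_conseq.
- apply: run_seq; apply: run_assign => //=; first by move=> _; exact: lt_const.
  apply: (run_for W0 (I := I) (N := n)) => //.
  + by split=> //=; rewrite hG /S big_ord0 addn0.
  + move=> i s1 lt_in [fr fc] [ha hG1].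
    have hn1 : regs s1 rn = n by rewrite fr.
    have tab1 : table_ok (cells s1) (sublist M n) by rewrite fc.
    have rows1 : rows_ok (cells s1) by have [] := tab1.
    split; first by rewrite /= hn1 ha test_gt0.
    have lt_i : i < n + 3 by rewrite ltn_addr.
    apply: run_seq; eapply run_conseq.
      by apply: (run_restrict (X := X) (i := i) (k := k)) => //; rewrite fr.
    + exact: leqnn.
    move=> s2 [fr2 fc2] hR.
    have tab2 : table_ok (cells s2) (sublist M n) by rewrite fc2.
    have hn2 : regs s2 rn = n by rewrite fr2.
    have ha2 : regs s2 ra = i by rewrite fr2.
    have ec : eval s2 (entry rc ra) = mem_nat (nbh_row c) i.
      by apply: eval_entry => //; [rewrite fr2 // fr|have [] := tab2].
    have et : eval s2 (Fetch (table_addr (Reg rR))) = num_stable e (X :&: nbh_row i :\: nbh_row k).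
      apply: eval_table tab2 => //; first by rewrite fr2 // fr.
      rewrite mem_sublistn inE; apply: subset_trans XM;
        apply: subset_trans (subsetDl _ _) (subsetIl _ _).
    have hS : eval s2 (Reg rG `+` entry rc ra `*` Fetch (table_addr (Reg rR))) = S i.+1.
      rewrite /S big_ord_recr /= addnA -/(S i) PoszD PoszM -ec -et -hG1.
      by rewrite -(fr2 rG).
    apply: run_seq; apply: run_assign => //; rewrite hS.
      move=> _; apply: leq_ltn_trans cap_lt; apply: leq_trans (_ : max_count <= _).
        apply: leq_trans (S_leq _) _; by rewrite ltnS leq_mul2r lt_in orbT.
      by rewrite /cap; move: (2 ^ n * max_count ^ n) => m; clear; lia.
    apply: run_assign => //=; rewrite ha2 -PoszD (addn1 i); last by split.
    by move=> _; apply: (@lt_index i.+1); rewrite ltn_addr.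
  + by move=> s1 [fr _] [ha _]; rewrite /= ha fr //= hn test_gt0 ltnn.
- by clear; lia.
- by move=> s' _ [].
Qed.

Definition spare : int := (l - Posz #|~: M|)%R.

Definition rank (i : nat) : nat := \sum_(u < i) mem_nat M u.

(** The first [spare] vertices of [M]. *)
Definition free_slots : {set 'I_n} := [set v in M | (Posz (rank v) < spare)%R].

Definition slot_row (v : 'I_n) : nat := if v \in M then n.+1 else v.

Definition weight_row (v : 'I_n) : nat :=
  if v \in M then if v \in free_slots then n.+2 else n.+1 else v.

Definition idle (v : 'I_n) : nat := (v \in M) && (v \notin free_slots).

Lemma num_slotE (v : 'I_n) X :
  num_slot e M free_slots v X = idle v + \sum_(w < n)
    mem_nat (nbh_row (weight_row v)) w * num_stable e (X :&: nbh_row w :\: nbh_row (slot_row v)).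
Proof.
have [esym eirr] := e_simple.
rewrite /num_slot (card_pairs (fun w S => slot e M free_slots v (S, w) && (S \subset X))).
rewrite /slot /weight_row /slot_row /idle.
case: (boolP (v \in M)) => vM; last first.
  rewrite add0n; apply: eq_bigr => w _; rewrite row_ord mem_natE !row_ord.
  have -> : (w \in closed_nbh e v) = (v \in closed_nbh e w).
    by rewrite !inE eq_sym esym.
  case: (v \in closed_nbh e w); last by rewrite mul0n; apply: eq_card0 => S;
    rewrite !inE !andbF.
  rewrite mul1n; apply: eq_card => S; rewrite !inE setDE !subsetI /=.
  by case: (stable e S); case: (S \subset X); case: (S \subset closed_nbh e w);
    case: (S \subset ~: closed_nbh e v).
case: (boolP (v \in free_slots)) => vQ.
  rewrite add0n; apply: eq_bigr => w _;
    rewrite row_full row_empty mem_natE inE mul1n row_ord setD0.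
  by apply: eq_card => S; rewrite !inE subsetI /= -andbA [X in _ && X]andbC.
rewrite row_empty [X in _ = _ + X]big1 ?addn0 => [|w _]; last by rewrite mem_natE inE.
rewrite (bigD1 v) //= big1 ?addn0 => [|w /negbTE wv]; last first.
  by apply: eq_card0 => S; rewrite !inE xpair_eqE wv andbF.
rewrite (_ : [set _ | _] = [set set0]) ?cards1 //.
apply/setP => S; rewrite !inE xpair_eqE eqxx andbT.
by case: eqP => // ->; rewrite sub0set.
Qed.

Lemma num_slot_leq (v : 'I_n) X : num_slot e M free_slots v X <= max_count.
Proof.
rewrite num_slotE /max_count -add1n leq_add ?leq_b1 //.
rewrite -[X in X * _]card_ord -sum_nat_const leq_sum // => w _.
rewrite -[X in _ <= X]mul1n leq_mul ?leq_b1 //.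
by apply: leq_trans (num_stable_leq _ _) _; rewrite card_ord.
Qed.

Lemma rank_card : rank n = #|M|.
Proof.
rewrite /rank -sum1_card [RHS]big_mkcond; apply: eq_bigr => u _.
by rewrite mem_natE; case: (u \in M).
Qed.

Lemma rankS i : rank i.+1 = rank i + mem_nat M i.
Proof. by rewrite /rank big_ord_recr. Qed.

Lemma card_free_slots :
  (#|free_slots| = #|M| \/ (l <= Posz (#|~: M| + #|free_slots|))%R) /\
  ((0 <= spare)%R -> (Posz (#|~: M| + #|free_slots|) <= l)%R).
Proof.
pose fr i := \sum_(u < i) (mem_nat M u && (Posz (rank u) < spare)%R).
have frS i : fr i.+1 = fr i + (mem_nat M i && (Posz (rank i) < spare)%R).
  by rewrite /fr big_ord_recr.
have frE : #|free_slots| = fr n.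
  rewrite /fr -sum1_card big_mkcond; apply: eq_bigr => u _.
  by rewrite mem_natE inE; case: (_ && _).
have inv i : [/\ fr i <= rank i, (0 <= spare)%R -> (Posz (fr i) <= spare)%R &
    fr i = rank i \/ (spare <= Posz (fr i))%R].
  elim: i => [|i [h1 h2 h3]]; first by rewrite /fr /rank !big_ord0; split=> //; left.
  rewrite frS rankS; case: (mem_nat M i) => /=; last by rewrite !addn0.
  case: (ltP (Posz (rank i)) spare) => /= h;
    move: (spare) (fr i) (rank i) h1 h2 h3 h => S f r.
    by clear; split; lia.
  by clear; split; lia.
have [_ h2 h3] := inv n; move: h2 h3; rewrite -frE rank_card /spare.
by move: #|free_slots| #|M| #|~: M| l; clear; lia.
Qed.

Lemma lt_ord (v : 'I_n) : v < 2 ^ W.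
Proof. by apply: lt_index; rewrite ltnW // ltn_addr. Qed.

Lemma lt_spare i : i <= n -> `|(spare - Posz (rank i))%R| < 2 ^ W.
Proof.
move=> lt_in; apply: leq_ltn_trans cap_lt.
have rk : rank i <= i.
  by rewrite /rank -[X in _ <= X]card_ord -sum1_card leq_sum // => u _; rewrite leq_b1.
have cM : #|~: M| <= n by rewrite -[X in _ <= X](card_ord n) max_card.
rewrite /spare /cap.
by move: (rank i) #|~: M| max_count (2 * 2 ^ n) (2 ^ n * _) rk cM lt_in; clear; lia.
Qed.

Lemma run_select_slot s (v : 'I_n) (X : {set 'I_n}) (z : int) :
  regs s rn = n -> rows_ok (cells s) -> regs s rX = encset X ->
  regs s rv = v -> regs s rp = Posz (2 ^ v) ->
  regs s rr = (spare - Posz (rank v))%R -> regs s rprod = z ->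
  run W select_slot s 10 (fun s' =>
    [/\ regs s' rb = slot_row v, regs s' rc = weight_row v, regs s' rG = idle v,
        regs s' rr = (spare - Posz (rank v.+1))%R &
        regs s' rprod = (z * slot_sign M v X)%R]).
Proof.
move=> hn rows hX hv hp hr hz; have W0 := W_gt0.
have eM : eval s (entry rn rv) = (v \in M).
  rewrite (eval_entry hn hn hv rows) // ?row_mod ?mem_natE //.
  by rewrite -[X in X < _]addn0 ltn_add2l.
have ebit : eval s (bit rX rp) = (v \in X).
  by rewrite (eval_bit (b := mem_nat X) (i := n) _ hp) ?mem_natE // hX encset_bitsum.
rewrite /slot_row /weight_row /idle rankS mem_natE /slot_sign.
apply: run_if => //; rewrite eM => vM; last first.
  have {}vM : (v \in M) = false by move: vM; case: (v \in M).
  rewrite vM /=; eapply run_conseq with (Q := fun s' =>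
    [/\ regs s' rb = v, regs s' rc = v, regs s' rG = 0,
        regs s' rr = (spare - Posz (rank v))%R & regs s' rprod = z]).
  - apply: run_seq; apply: run_assign => //=; rewrite hv; first by move=> _;
      apply: lt_ord.
    apply: run_seq; apply: run_assign => //=; rewrite hv; first by move=> _;
      apply: lt_ord.
    by apply: run_assign => //=; move=> _; exact: lt_const.
  - by [].
  - by move=> s' _ [? ? ? ? ?]; split=> //; rewrite ?rankS ?mem_natE ?vM ?addn0 ?mulr1.
have {}vM : v \in M by move: vM; case: (v \in M).
rewrite vM /=.
eapply run_conseq with (Q := fun s' =>
  [/\ regs s' rb = n.+1, regs s' rc = (if v \in free_slots then n.+2 else n.+1),
      regs s' rG = (v \notin free_slots),
      regs s' rr = (spare - Posz (rank v.+1))%R &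
      regs s' rprod = (z * (if v \notin X then -1 else 1))%R]).
- apply: run_seq; eapply run_conseq with (Q := fun s1 =>
    regs s1 rprod = (z * (if v \notin X then -1 else 1))%R).
  + apply: run_if => //; rewrite ebit => vX.
      have {}vX : v \in X by move: vX; case: (v \in X).
      by apply: run_skip => //; rewrite vX mulr1.
    have {}vX : v \notin X by move: vX; case: (v \in X).
    apply: run_assign => //=; rewrite hz sub0r; last by rewrite vX mulrN1.
    by move=> [bR _]; have := bR rprod; rewrite hz abszN.
  + exact: leqnn.
  move=> s1 [fr1 _] hz1.
  have hn1 : regs s1 rn = n by rewrite fr1.
  have hr1 : regs s1 rr = (spare - Posz (rank v))%R by rewrite fr1.
  apply: run_seq; apply: run_assign => //=; rewrite hn1 -PoszD (addn1 n).
    by move=> _; apply: (@lt_index n.+1); rewrite -addn1 leq_add2l.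
  apply: run_seq; eapply run_conseq with (Q := fun s2 =>
    regs s2 rc = (if v \in free_slots then n.+2 else n.+1) /\ regs s2 rG = (v \notin free_slots)).
  + have vQ : (v \in free_slots) = (0 < spare - Posz (rank v))%R by rewrite inE vM subr_gt0.
    apply: run_if => //=; rewrite hr1 -vQ => h.
      rewrite h; apply: run_seq; apply: run_assign => //=; rewrite hn1 -PoszD (addn2 n).
        by move=> _; apply: (@lt_index n.+2); rewrite -addn2 leq_add2l.
      by apply: run_assign => //=; move=> _; exact: lt_const.
    rewrite (negbTE h); apply: run_seq; apply: run_assign => //=;
      rewrite hn1 -PoszD (addn1 n).
      by move=> _; apply: (@lt_index n.+1); rewrite -addn1 leq_add2l.
    by apply: run_assign => //=; move=> _; exact: lt_const.
  + exact: leqnn.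
  move=> s2 [fr2 _] [hc2 hG2].
  have hrS : (regs s2 rr - 1)%R = (spare - Posz (rank v.+1))%R.
    by rewrite fr2 //= hr1 rankS mem_natE vM PoszD opprD addrA.
  apply: run_assign => //=; rewrite hrS.
    by move=> _; apply: lt_spare.
  by split=> //=; rewrite fr2.
- by [].
- by move=> s' _ []; rewrite rankS mem_natE vM; split.
Qed.

Definition slot_factor (X : {set 'I_n}) (i : nat) : int :=
  if insub i is Some v then
    (slot_sign M v X * Posz (num_slot e M free_slots v X))%R
  else 1%R.

Lemma slot_factorE X (v : 'I_n) :
  slot_factor X v = (slot_sign M v X * Posz (num_slot e M free_slots v X))%R.
Proof. by rewrite /slot_factor valK. Qed.

Lemma slot_product_leq X i :
  i <= n -> `|(\prod_(v < i) slot_factor X v)%R| <= max_count ^ i.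
Proof.
elim: i => [|i IH] lt_in; first by rewrite big_ord0.
rewrite big_ord_recr /= expnSr abszM leq_mul //; first exact/IH/ltnW.
rewrite (slot_factorE X (Ordinal lt_in)) abszM /slot_sign.
by case: ifP => _; rewrite ?abszN absz1 mul1n; apply: num_slot_leq.
Qed.

Lemma lt_product (z : int) : `|z| <= 2 ^ n * max_count ^ n -> `|z| < 2 ^ W.
Proof.
move=> hz; apply: leq_ltn_trans cap_lt; apply: leq_trans hz _.
by rewrite /cap leq_addl.
Qed.

Lemma run_product s X :
  regs s rn = n -> regs s rbase = base -> regs s rX = encset X -> X \subset M ->
  regs s rprod = 1%R -> regs s rr = spare -> regs s rv = 0 -> regs s rp = 1%R ->
  table_ok (cells s) (sublist M n) ->
  run W (While (Reg rn `-` Reg rv) product_body) s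
      (n * (n * (4 * n + 7) + 16)).+1
      (fun s' => regs s' rprod = \prod_(v < n) slot_factor X v)%R.
Proof.
move=> hn hbase hX XM hprod hr hv hp tab; have W0 := W_gt0.
pose I (i : nat) (s' : state) :=
  [/\ regs s' rprod = (\prod_(v < i) slot_factor X v)%R,
      regs s' rr = (spare - Posz (rank i))%R, regs s' rv = i &
      regs s' rp = Posz (2 ^ i)].
eapply run_conseq; first apply: (run_for W0 (I := I) (N := n)) => //.
- by split=> //; rewrite ?big_ord0 // /rank big_ord0 subr0.
- move=> i s1 lt_in [fr fc] [hprod1 hr1 hv1 hp1]; pose v := Ordinal lt_in.
  have hn1 : regs s1 rn = n by rewrite fr.
  have tab1 : table_ok (cells s1) (sublist M n) by rewrite fc.
  split; first by rewrite /= hn1 hv1 test_gt0.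
  apply: run_seq; eapply run_conseq.
  + apply: (run_select_slot (v := v) (X := X) hn1 _ _ hv1 hp1 hr1 hprod1);
      last by rewrite fr.
    by have [] := tab1.
  + exact: leqnn.
  move=> s2 [fr2 fc2] [hb2 hc2 hG2 hr2 hprod2].
  apply: run_seq; eapply run_conseq.
  + apply: (run_count_slot (X := X) (k := slot_row v) (c := weight_row v) (g := idle v)) => //.
    * by rewrite fr2.
    * by rewrite fr2 // fr.
    * by rewrite fr2 // fr.
    * by rewrite /slot_row; case: ifP => _; [rewrite -addn1 ltn_add2l|rewrite ltn_addr].
    * by rewrite /weight_row; do 2?case: ifP => _;
        [rewrite -addn2 ltn_add2l|rewrite -addn1 ltn_add2l|rewrite ltn_addr].
    * exact: leq_b1.
    * by rewrite fc2.
  + exact: leqnn.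
  move=> s3 [fr3 fc3]; rewrite -num_slotE => hG3.
  have hprod3 : (regs s3 rprod * regs s3 rG = \prod_(u < i.+1) slot_factor X u)%R.
    by rewrite hG3 fr3 // hprod2 big_ord_recr /= (slot_factorE X v) mulrA.
  have hp3 : (regs s3 rp + regs s3 rp)%R = Posz (2 ^ i.+1).
    by rewrite fr3 // fr2 // hp1 -PoszD addnn -mul2n -expnS.
  have hv3 : regs s3 rv = i by rewrite fr3 // fr2.
  apply: run_seq; apply: run_assign => //=; rewrite hprod3.
    move=> _; apply: lt_product; apply: leq_trans (slot_product_leq X lt_in) _.
    apply: leq_trans (_ : max_count ^ n <= _); first by rewrite leq_pexp2l.
    by rewrite leq_pmull // expn_gt0.
  apply: run_seq; apply: run_assign => //=; rewrite hp3.
    move=> _; apply: (@lt_double (2 ^ i.+1));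
      rewrite (@leq_trans (2 ^ n)) ?leq_pmull //.
    by rewrite leq_exp2l.
  apply: run_assign => //=; rewrite hv3 -PoszD (addn1 i); last by split=> //=;
    rewrite fr3.
  by move=> _; apply: (@lt_index i.+1); rewrite ltn_addr.
- by move=> s1 [fr _] [_ _ hv1 _]; rewrite /= hv1 fr //= hn test_gt0 ltnn.
- by clear; nia.
- by move=> s' _ [].
Qed.

Lemma run_sum_products s :
  regs s rn = n -> regs s rbase = base -> regs s rq = spare ->
  regs s rsz = size (sublist M n) -> table_ok (cells s) (sublist M n) ->
  run W sum_products s
      (2 ^ #|M| * (n * (n * (4 * n + 7) + 16) + 9) + 3)
      (fun s' => regs s' rsum = slot_sum e M free_slots).
Proof.
move=> hn hbase hq hsz tab; have W0 := W_gt0.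
pose L := sublist M n; pose P X := (\prod_(v < n) slot_factor X v)%R.
pose I (j : nat) (s' : state) :=
  regs s' rj = j /\ regs s' rsum = (\sum_(X <- take j L) P X)%R.
have sum_leq j : `|(\sum_(X <- take j L) P X)%R| <= size (take j L) * max_count ^ n.
  elim: (take j L) => [|X Ls IH]; first by rewrite big_nil.
  rewrite big_cons /= mulSn;
    apply: leq_trans (_ : `|P X| + `|(\sum_(Y <- Ls) P Y)%R| <= _).
    by move: (P X) (bigop.body _ _ _) => a b; clear; lia.
  by rewrite leq_add // slot_product_leq.
eapply run_conseq.
- do 2 (apply: run_seq; apply: run_assign => //=; first by move=> _; exact: lt_const).
  apply: (run_for W0 (I := I) (N := size L)) => //.
  + by split=> //=; rewrite take0 big_nil.
  + move=> j s1 lt_j [fr fc] [hj hsum]; pose X := nth set0 L j.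
    have hn1 : regs s1 rn = n by rewrite fr.
    have hbase1 : regs s1 rbase = base by rewrite fr.
    have tab1 : table_ok (cells s1) L by rewrite fc.
    split; first by rewrite /= fr //= hsz hj test_gt0.
    have XM : X \subset M by apply: (@sublist_sub _ _ n) => //; apply: mem_nth.
    have eX : eval s1 (Fetch (list_addr (Reg rj))) = encset X.
      exact: (eval_list (a := Reg rj) hbase1 hj lt_j tab1).
    apply: run_seq; apply: run_assign => //; rewrite eX; first by move=> _;
      apply: encset_small.
    apply: run_seq; apply: run_assign => //=; first by move=> _; exact: lt_const.
    have hq1 : regs s1 rq = spare by rewrite fr.
    apply: run_seq; apply: run_assign => //=; rewrite hq1.
      by move=> _; have := @lt_spare 0 isT; rewrite /rank big_ord0 subr0.
    do 2 (apply: run_seq; apply: run_assign => //=; first by move=> _; exact: lt_const).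
    apply: run_seq; eapply run_conseq; first exact: (run_product (X := X)).
      exact: leqnn.
    move=> s2 [fr2 _] hprod2.
    have hsum2 : (regs s2 rsum + regs s2 rprod)%R = (\sum_(Y <- take j.+1 L) P Y)%R.
      by rewrite hprod2 fr2 //= hsum (take_nth set0) // -cats1 big_cat big_seq1.
    have hj2 : regs s2 rj = j by rewrite fr2.
    apply: run_seq; apply: run_assign => //=; rewrite hsum2.
      move=> _; apply: lt_product; apply: leq_trans (sum_leq _) _.
      rewrite leq_mul2r; apply/orP; right.
      by rewrite size_takel // (leq_trans lt_j) // size_sublist_small.
    apply: run_assign => //=; rewrite hj2 -PoszD (addn1 j); last by split.
    by move=> _; apply: (@lt_double j.+1);
      rewrite (leq_trans lt_j) // (leq_trans (size_sublist_small _)) // leq_pmull.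
  + by move=> s1 [fr _] [hj _]; rewrite /= hj fr //= hsz test_gt0 ltnn.
- have := size_sublist M (leqnn n); rewrite -/L.
  by move: (size L) (2 ^ #|M|) (n * (n * _ + 16)); clear; nia.
- move=> s' _ [_ ->]; rewrite take_size /slot_sum -sum_sublist.
  by apply: eq_bigr => X _; apply: eq_bigr => v _; rewrite slot_factorE.
Qed.

Lemma entry_addr_eq r r' k k' : k < n -> k' < n ->
  (2 + r * n + k == 2 + r' * n + k') = (r == r') && (k == k').
Proof.
move=> lt_k lt_k'; rewrite -!addnA eqn_add2l.
have n0 : 0 < n by apply: leq_ltn_trans lt_k.
apply/eqP/andP => [eq_rk|[/eqP-> /eqP->//]].
have : (r * n + k) %/ n = (r' * n + k') %/ n by rewrite eq_rk.
rewrite !divnMDl // !divn_small // !addn0 => rr'.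
by move: eq_rk; rewrite rr' => /addnI ->.
Qed.

Definition prepared (i : nat) (c : nat -> int) : Prop :=
  [/\ forall u v : 'I_n, c (2 + u * n + v) = e u v || (u == v) && (u < i),
      forall v : 'I_n, c (2 + n * n + v) = (v \in M),
      forall v : 'I_n, c (2 + n.+1 * n + v) = 0 &
      forall v : 'I_n, v < i -> c (2 + n.+2 * n + v) = 1%R].

Lemma preparedS (i : 'I_n) c : prepared i c ->
  prepared i.+1 (fun b => if b == 2 + n.+2 * n + i then 1%R
                          else if b == 2 + i * n + i then 1%R else c b).
Proof.
have row_neq (u : 'I_n) r : n <= r -> (u == r :> nat) = false.
  by move=> nr; rewrite ltn_eqF // (leq_trans (ltn_ord u)).
have row_neq' (u : 'I_n) r : n <= r -> (r == u :> nat) = false.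
  by rewrite eq_sym; apply: row_neq.
have nSS : n <= n.+2 by rewrite leqW.
move=> [he hM h0 h1]; split=> [u v|v|v|v lt_v]; rewrite !entry_addr_eq //.
- rewrite he (row_neq u _ nSS) ltnS (leq_eqVlt u i) andFb.
  rewrite !val_eqE; have [->|//] := eqVneq u i.
  by rewrite ltnn (eq_sym v) andTb orTb andbT andbF orbF; case: eqP => _;
    rewrite ?orbT ?orbF.
- by rewrite hM (row_neq' i n) // (ltn_eqF (leqnSn n.+1)).
- by rewrite h0 (row_neq' i n.+1) // (ltn_eqF (ltnSn n.+1)).
- rewrite eqxx (row_neq' i _ nSS) !andFb andTb; case: eqP => // vi; apply: h1.
  by rewrite ltn_neqAle -ltnS lt_v andbT; apply/eqP.
Qed.

Lemma prepared_rows c : prepared n c -> rows_ok c.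
Proof.
move=> [he hM h0 h1] r k lt_r lt_k; pose v := Ordinal lt_k.
rewrite (mem_natE (nbh_row r) v); have [lt_rn|] := ltnP r n.
  rewrite (he (Ordinal lt_rn) v) (row_ord (Ordinal lt_rn)) !inE lt_rn andbT orbC.
  by rewrite eq_sym.
rewrite leq_eqVlt => /orP[/eqP <-|]; first by rewrite (hM v) row_mod.
rewrite leq_eqVlt => /orP[/eqP <-|]; first by rewrite (h0 v) row_empty inE.
rewrite leq_eqVlt => /orP[/eqP <-|]; first by rewrite (h1 v) // row_full inE.
by move: lt_r; rewrite addn3 ltnS leqNgt => /negbTE->.
Qed.

Lemma encode_prepared : prepared 0 (cells (init (encode e l M))).
Proof.
have size_adj : size [seq Posz (e u v) | u <- enum 'I_n, v <- enum 'I_n] = n * n.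
  by rewrite size_allpairs size_enum_ord.
have size_mod : size [seq Posz (v \in M) | v <- enum 'I_n] = n.
  by rewrite size_map size_enum_ord.
split=> [u v|v|v|//]; rewrite /= -addnA /= ?addSn ?add0n /= nth_cat size_adj.
- have lt_uv : u * n + v < n * n.
    apply: leq_trans (_ : u.+1 * n <= _); first by rewrite mulSn addnC ltn_add2r.
    by rewrite leq_mul2r ltn_ord orbT.
  rewrite lt_uv andbF orbF.
  have := nth_allpairs (fun u v => Posz (e u v)) u v 0%R
            (s := enum 'I_n) (t := enum 'I_n) (i := u) (j := v).
  by rewrite !size_enum_ord !nth_ord_enum => ->.
- rewrite ltnNge leq_addr addKn /=.
  by rewrite (nth_map v) ?size_enum_ord // nth_ord_enum.
- rewrite mulSn ifN; last by clear; lia.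
  by rewrite nth_default // size_mod; clear; lia.
Qed.

Lemma bounded_init : bounded W (init (encode e l M)).
Proof.
split=> [x|a] /=; first by rewrite expn_gt0.
have mem_small z : z \in encode e l M -> `|z| < 2 ^ W.
  rewrite !inE mem_cat => /or3P[/eqP->|/eqP->|/orP[/allpairsP[p [_ _ ->]]|/mapP[v _ ->]]].
  - by apply: (@lt_index n); rewrite leq_addr.
  - by apply: leq_ltn_trans cap_lt; rewrite /cap;
      move: max_count (2 ^ n * _) (2 * 2 ^ n); clear; lia.
  - by apply: lt_const; case: (e _ _).
  - by apply: lt_const; case: (_ \in _).
have [lt_a|ge_a] := ltnP a (size (encode e l M)); first by apply: mem_small;
  rewrite mem_nth.
by rewrite (nth_default _ ge_a) expn_gt0.
Qed.

Lemma run_prepare :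
  run W prepare (init (encode e l M)) (n * 7 + 5)
      (fun s' => [/\ regs s' rn = n, regs s' rbase = base, regs s' rq = spare &
                     rows_ok (cells s')]).
Proof.
have W0 := W_gt0; set s := init _; have prep0 := encode_prepared; rewrite -/s in prep0.
pose m (i : nat) := \sum_(u < i) ~~ mem_nat M u.
have m_leq i : m i <= i.
  by rewrite /m -[X in _ <= X]card_ord -sum1_card leq_sum // => u _; rewrite leq_b1.
have mE : m n = #|~: M|.
  rewrite /m -sum1_card [RHS]big_mkcond; apply: eq_bigr => u _.
  by rewrite mem_natE inE; case: (u \in M).
have lt_q i : i <= n -> `|(l - Posz (m i))%R| < 2 ^ W.
  move=> lt_in; apply: leq_ltn_trans cap_lt; rewrite /cap.
  by move: (m i) max_count (2 * 2 ^ n) (2 ^ n * _) (m_leq i) lt_in; clear; lia.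
pose I (i : nat) (s' : state) := [/\ regs s' ru = i, regs s' rq = (l - Posz (m i))%R &
  prepared i (cells s')].
eapply run_conseq with (Q := fun s' => [/\ regs s' rn = n, regs s' rbase = base & I n s']).
- apply: run_seq; apply: run_assign => //=; first by move=> _; apply: (@lt_index n);
    rewrite leq_addr.
  apply: run_seq; apply: run_assign => //=.
    by move=> _; apply: (@lt_small base); rewrite /base; clear; lia.
  apply: run_seq; apply: run_assign => //=.
    by move=> _; have := lt_q 0 isT; rewrite /m big_ord0 subr0.
  apply: run_seq; apply: run_assign => //=; first by move=> _; exact: lt_const.
  eapply run_conseq; first apply: (run_for W0 (I := I) (N := n)) => //.
  + by split=> //=; rewrite /m big_ord0 subr0.
  + move=> i s1 lt_in [fr _] [hu hq prep]; pose v := Ordinal lt_in.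
    have hn1 : regs s1 rn = n by rewrite fr.
    split; first by rewrite /= hn1 hu test_gt0.
    have prepS := preparedS (i := v) prep.
    apply: run_seq; apply: run_store => //=; first by move=> _; exact: lt_const.
    apply: run_seq; apply: run_store => //=; first by move=> _; exact: lt_const.
    rewrite hn1 hu (_ : (Posz n + 2%Z)%R = Posz n.+2); last by rewrite -PoszD addn2.
    set s2 := set_mem _ _ _.
    have prep2 : prepared i.+1 (cells s2) by exact: prepS.
    have eM : eval s2 (entry rn ru) = (v \in M).
      by have [_ <- _ _] := prep2; rewrite [eval _ _]/= hn1 hu.
    have hq2 : eval s2 (Reg rq `-` K 1 `+` entry rn ru) = (l - Posz (m i.+1))%R.
      transitivity (regs s2 rq - 1 + eval s2 (entry rn ru))%R => //.
      rewrite eM /= hq /m big_ord_recr /= (mem_natE M v).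
      by move: (\sum_(u < i) _) => k; case: (v \in M); clear; lia.
    apply: run_seq; apply: run_assign => //; rewrite hq2; first by move=> _;
      apply: lt_q.
    apply: run_assign => //=; rewrite hu -PoszD (addn1 i); last by split.
    by move=> _; apply: (@lt_index i.+1); rewrite ltn_addr.
  + by move=> s1 [fr _] [hu _ _]; rewrite /= hu fr //= test_gt0 ltnn.
  + exact: leqnn.
  by move=> s1 [fr _] Is1; split=> //; rewrite fr.
- by clear; lia.
- by move=> s' _ [hn hbase [_ hq /prepared_rows rows]]; split; rewrite // hq mE.
Qed.

Lemma run_cd_program :
  run W cd_program (init (encode e l M))
      (n * 7 + n.+1 * (2 ^ #|M| * (4 * n + 11) + 20) +
       2 ^ #|M| * (n * (n * (4 * n + 7) + 16) + 9) + 11)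
      (fun s' => regs s' rans =
         ((0 <= spare)%R && (0 < slot_sum e M free_slots)%R : bool)).
Proof.
have W0 := W_gt0; eapply run_conseq.
- apply: run_seq; eapply run_conseq; [exact: run_prepare|exact: leqnn|].
  move=> s1 _ [hn hbase hq rows].
  apply: run_seq; eapply run_conseq; [exact: run_fill_table|exact: leqnn|].
  move=> s2 [fr2 _] [hsz tab].
  apply: run_seq; eapply run_conseq.
  + by apply: run_sum_products => //; rewrite fr2.
  + exact: leqnn.
  move=> s3 [fr3 _] hsum.
  have hq3 : regs s3 rq = spare by rewrite fr3 // fr2.
  eapply run_conseq with (Q := fun s' => regs s' rans =
         ((0 <= spare)%R && (0 < slot_sum e M free_slots)%R : bool)).
  + apply: run_if => //=; rewrite hq3 ltzD1 => h.
      rewrite h /=; apply: run_if => //=; rewrite hsum => h'.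
        by rewrite h'; apply: run_assign => //= _; exact: lt_const.
      by rewrite (negbTE h'); apply: run_assign => //= _; exact: lt_const.
    rewrite (negbTE h); eapply run_conseq.
    * by apply: (run_assign W0 (Q := fun s' => regs s' rans = 0)) => //= _;
        exact: lt_const.
    * by [].
    * by [].
  + exact: leqnn.
  by move=> s' _ h; exact: h.
- move: (n.+1 * (2 ^ #|M| * (4 * n + 11) + 20)) => a.
  by move: (2 ^ #|M| * (n * (n * (4 * n + 7) + 16) + 9)) => b; clear; lia.
- by [].
Qed.

Hypothesis M_mod : clique_modulator e M.

Lemma has_CD_coloringP :
  reflect (has_CD_coloring e l) ((0 <= spare)%R && (0 < slot_sum e M free_slots)%R).
Proof.
have [hQ hl] := card_free_slots.
have QM : free_slots \subset M by apply/subsetP => v; rewrite inE => /andP[].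
apply: (iffP andP) => [[h /slot_sum_gt0[f [sl UM]]]|].
  by apply: (slots_coloring e_simple sl UM); apply: hl.
move=> /(coloring_slots e_simple M_mod QM hQ)[h hf]; split; last exact/slot_sum_gt0.
by rewrite /spare subr_ge0.
Qed.

End Correctness.

Lemma input_size_geq n (e : rel 'I_n) (l : int) (M : {set 'I_n}) :
  n * n + n + bits l < input_size (encode e l M).
Proof.
rewrite /input_size /encode !big_cons.
set s := (X in \sum_(z <- X) _).
have : size s <= \sum_(z <- s) bits z.
  by rewrite -sum1_size leq_sum.
rewrite size_cat size_allpairs size_map !size_enum_ord.
by have : 0 < bits n by []; lia.
Qed.

Lemma cap_leq n (l : int) S : n * n + n + bits l < S -> cap n l < 2 ^ (5 * S).
Proof.
move=> hS.
have n_lt : n < 2 ^ n by rewrite ltn_expl.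
have max_leq : max_count n <= 2 ^ (2 * n).
  by rewrite mul2n -addnn expnD /max_count; move: (2 ^ n) n_lt => m; clear; nia.
have pow_mono a b i : a <= b -> a ^ i <= b ^ i by case: i => // i; rewrite leq_exp2r.
have prod_leq : 2 ^ n * max_count n ^ n <= 2 ^ (2 * S).
  apply: leq_trans (_ : 2 ^ n * (2 ^ (2 * n)) ^ n <= _);
    first by rewrite leq_mul ?pow_mono.
  by rewrite -expnM -expnD leq_exp2l //; move: (bits l) hS; clear; nia.
have max_leq' : max_count n <= 2 ^ (2 * S).
  by apply: leq_trans max_leq _; rewrite leq_exp2l //; move: (bits l) hS; clear; nia.
have l_leq : `|l| <= 2 ^ (2 * S).
  apply: leq_trans (ltnW (absz_lt_bits l)) _; rewrite leq_exp2l //.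
  by move: (bits l) hS; clear; nia.
have pow_leq : 2 ^ n <= 2 ^ (2 * S).
  by rewrite leq_exp2l //; move: (bits l) hS; clear; nia.
have S_leq : S < 2 ^ (2 * S).
  by apply: leq_trans (ltn_expl S (isT : 1 < 2)) _; rewrite leq_exp2l // leq_pmull.
have bits_gt0 : 0 < bits l by [].
have S_gt1 : 2 <= S by move: (bits l) bits_gt0 hS; clear; lia.
have big : 32 <= 2 ^ (3 * S - 1) by rewrite (@leq_exp2l 2 5) //; move: S_gt1; clear;
  lia.
have -> : 2 ^ (5 * S) = 2 ^ (2 * S) * 2 * 2 ^ (3 * S - 1).
  by rewrite -mulnA -expnS -expnD; congr (2 ^ _); move: S_gt1; clear; lia.
rewrite /cap; move: (2 ^ n * _) prod_leq => P hP; move: (max_count n) max_leq' => m hm.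
move: (2 ^ (2 * S)) (2 ^ (3 * S - 1)) (2 ^ n) pow_leq S_leq big hP hm l_leq hS S_gt1 => a b c.
move: `|l| (bits l) => x y; clear => hc hS hb hP hm hx h2 S1.
have : n * n + 5 * n + 10 <= 10 * S by nia.
by nia.
Qed.

Lemma cd_steps_leq n k S : n * n + n < S ->
  n * 7 + n.+1 * (k.+1 * (4 * n + 11) + 20) +
  k.+1 * (n * (n * (4 * n + 7) + 16) + 9) + 11 <= 200 * S ^ 2 * k.+1.
Proof.
move=> hS.
have n3 : n * n * n <= S * S by apply: leq_mul; lia.
have n2 : n * n <= S * S by apply: leq_trans (_ : S * 1 <= _); nia.
have n1 : n <= S * S by nia.
have n0 : 1 <= S * S by nia.
by rewrite expnS expn1; nia.
Qed.

Theorem theorem8 :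
  exists (p : cmd) (c d : nat),
    forall (n : nat) (e : rel 'I_n) (l : int) (M : {set 'I_n}),
      simple_graph e -> clique_modulator e M ->
      decides_within p (encode e l M) (has_CD_coloring e l)
        (c * input_size (encode e l M) ^ d * 2 ^ #|M|).
Proof.
exists cd_program, (200 * (unit_factor * 25)), 4 => n e l M e_simple M_mod.
have hS := input_size_geq e l M; set S := input_size _ in hS *.
have hcap := cap_leq hS.
have [t [s [ex ht _ ans]]] := run_cd_program e_simple hcap (bounded_init e M hcap).
exists t, s; split=> //; last first.
  by move: ans; case: (has_CD_coloringP l e_simple M_mod) => h ->; [left|right].
apply: leq_trans ht _.
have hS' : n * n + n < S by apply: leq_ltn_trans hS; rewrite leq_addr.
have k_gt0 : 0 < 2 ^ #|M| by rewrite expn_gt0.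
have := cd_steps_leq (2 ^ #|M|).-1 hS'; rewrite prednK //.
move: (2 ^ #|M|) (n * 7 + _ + _ + _) => k T hT.
apply: leq_trans (leq_mul hT (leqnn _)) _.
by move: unit_factor => U; rewrite leq_eqVlt; apply/orP; left; apply/eqP; clear; ring.
Qed.
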